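(* Let $\mathcal{C}$ be any concept class with probabilistic representation dimension $d=\mathrm{PRDim}(\mathcal{C})$ and VC dimension $d_{\mathrm{VC}}$. Then, for any sufficiently small $\alpha,\varepsilon>0$ and all $m\in\mathbb{N}$, \[ n_m^{\mathrm{agn}(\mathcal{C};\alpha)}(\varepsilon,\delta=0)\le\tilde{O}\left(\frac{d}{\varepsilon}+\frac{d}{\alpha\varepsilon\sqrt{m}}+\frac{d}{\alpha^2 m}\right) \] and \[ n_m^{\mathrm{agn}(\mathcal{C};\alpha)}(\varepsilon,\delta=0)\ge\tilde{\Omega}\left(\frac{d}{\varepsilon}+\frac{d_{\mathrm{VC}}}{\alpha\varepsilon\sqrt{m}}+\frac{d_{\mathrm{VC}}}{\alpha^2 m}\right). \]
   Context: User-level DP: there are $n$ users each holding $m$ examples from a domain $\mathcal{Z}$; two inputs in $\mathcal{Z}^{nm}$ are user-level neighbors if they differ only in one user's $m$ examples; an algorithm with finite output set is $(\varepsilon,\delta)$-user-level DP if $\Pr[\mathbf{A}(\mathbf{x})\in S]\le e^\varepsilon\Pr[\mathbf{A}(\mathbf{x}')\in S]+\delta$ for all neighbors and all output sets $S$. For a task with correct-answer sets $\Psi(\mathcal{D})$, $n_m(\varepsilon,\delta)$ is the smallest $n$ such that some $(\varepsilon,\delta)$-user-level DP algorithm, given $nm$ i.i.d. samples from $\mathcal{D}$ grouped into $n$ users, outputs an element of $\Psi(\mathcal{D})$ with probability at least $2/3$ for every valid $\mathcal{D}$. Here $\mathcal{Z}=\mathcal{X}\times\{0,1\}$, $\mathcal{C}\subseteq\{0,1\}^{\mathcal{X}}$,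 $\mathrm{Err}_{\mathcal{D}}(c)=\Pr_{(x,y)\sim\mathcal{D}}[c(x)\ne y]$. In the agnostic task $\mathrm{agn}(\mathcal{C};\alpha)$ every distribution $\mathcal{D}$ on $\mathcal{Z}$ is valid and the correct outputs are $c:\mathcal{X}\to\{0,1\}$ with $\mathrm{Err}_{\mathcal{D}}(c)\le\min_{c'\in\mathcal{C}}\mathrm{Err}_{\mathcal{D}}(c')+\alpha$. A distribution $\mathcal{P}$ over finite sets $\mathcal{H}$ of functions $\mathcal{X}\to\{0,1\}$ is an $(\alpha,\beta)$-probabilistic representation of $\mathcal{C}$ if for every $c\in\mathcal{C}$ and every distribution $\mathcal{D}_{\mathcal{X}}$ on $\mathcal{X}$, with probability $1-\beta$ over $\mathcal{H}\sim\mathcal{P}$ there is $h\in\mathcal{H}$ with $\Pr_{x\sim\mathcal{D}_{\mathcal{X}}}[c(x)\ne h(x)]\le\alpha$; $\mathrm{size}(\mathcal{P})=\max_{\mathcal{H}\in\mathrm{supp}(\mathcal{P})}\log|\mathcal{H}|$; $\mathrm{PRDim}(\mathcal{C})$ is the minimum of $\mathrm{size}(\mathcal{P})$ over $(1/4,1/4)$-probabilistic representations. $\tilde{O},\tilde{\Omega}$ hide polylogarithmic factors. *)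

(* Defs.v *)
From HB Require Import structures.
From mathcomp Require Import all_boot all_order all_algebra finmap.
From mathcomp Require Import all_classical all_reals all_analysis.

Set Implicit Arguments.
Unset Strict Implicit.
Unset Printing Implicit Defensive.
Import Order.TTheory GRing.Theory Num.Theory.

Local Open Scope classical_set_scope.
Local Open Scope ring_scope.
Local Open Scope ereal_scope.

Section iid.
Context (disp : measure_display) (T : measurableType disp) (R : realType).

Definition tcons (n : nat) (z : T * n.-tuple T) : n.+1.-tuple T :=
  [tuple of z.1 :: z.2].

Lemma measurable_tcons (n : nat) : measurable_fun [set: T * n.-tuple T] (@tcons n).
Proof. exact: (measurable_cons measurable_fst measurable_snd). Qed.

HB.instance Definition _ (n : nat) :=
  isMeasurableFun.Build _ _ _ _ (@tcons n) (@measurable_tcons n).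

(* The n-fold product measure, i.e. the law of n i.i.d. samples from D. *)
Fixpoint iid (D : probability T R) (n : nat) : probability (n.-tuple T) R :=
  match n with
  | 0 => dirac [tuple]
  | n'.+1 => distribution (D \x iid D n') (@tcons n')
  end.

End iid.

Section user_level_DP.
Context (disp : measure_display) (Z : measurableType disp) (R : realType)
  (O : choiceType).

(* Entry i of a dataset is the m-tuple of examples of user i. *)
Definition dataset (n m : nat) := n.-tuple (m.-tuple Z).

Definition user_neighbors (n m : nat) (x x' : dataset n m) : Prop :=
  exists i : 'I_n, forall j : 'I_n, j != i -> tnth x j = tnth x' j.

(* A randomized algorithm with finite output set: alg_prob x o is the
   probability of the output o on input x.  Measurability in x makes
   probabilities over random inputs meaningful. *)
Record algorithm (n m : nat) := Algorithm {
  alg_outputs : {fset O} ;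
  alg_prob : dataset n m -> O -> R ;
  alg_prob_ge0 : forall x o, (0 <= alg_prob x o)%R ;
  alg_prob_supp : forall x o, o \notin alg_outputs -> alg_prob x o = 0%R ;
  alg_prob_sum1 : forall x, (\sum_(o <- alg_outputs) alg_prob x o)%R = 1%R ;
  alg_prob_measurable : forall o, measurable_fun [set: dataset n m] (alg_prob ^~ o)
}.

Definition alg_in (n m : nat) (A : algorithm n m) (x : dataset n m) (S : set O) : R :=
  (\sum_(o <- alg_outputs A | o \in S) alg_prob A x o)%R.

Definition user_level_DP (n m : nat) (eps delta : R) (A : algorithm n m) : Prop :=
  forall (x x' : dataset n m) (S : set O), user_neighbors x x' ->
    (alg_in A x S <= expR eps * alg_in A x' S + delta)%R.

Record task := Task {
  task_valid : set (probability Z R) ;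
  task_correct : probability Z R -> set O
}.

Definition solves (n m : nat) (T : task) (A : algorithm n m) : Prop :=
  forall D : probability Z R, task_valid T D ->
    (2 / 3)%:E <= \int[iid (iid D m) n]_x (alg_in A x (task_correct T D))%:E.

(* n_m^T(eps, delta); equal to +oo if no number of users suffices. *)
Definition user_complexity (T : task) (m : nat) (eps delta : R) : \bar R :=
  ereal_inf [set n%:R%:E | n in [set n : nat |
    exists A : algorithm n m, user_level_DP eps delta A /\ solves T A]].

End user_level_DP.

Section learning.
Context (disp : measure_display) (X : measurableType disp) (R : realType).

Definition hypothesis := {mfun X >-> bool}.

Definition Err (D : probability (X * bool)%type R) (c : hypothesis) : \bar R :=
  D [set z | c z.1 != z.2].

Definition agn (C : set hypothesis) (alpha : R) :
    task (X * bool)%type R hypothesis :=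
  Task [set: probability (X * bool)%type R]
    (fun D => [set c | Err D c <= ereal_inf [set Err D c' | c' in C] + alpha%:E]).

Definition shatters (C : set hypothesis) (S : {fset X}) : Prop :=
  forall S' : set X, exists2 c, C c & forall x, x \in S -> (c x : Prop) <-> S' x.

Definition VCdim (C : set hypothesis) : \bar R :=
  ereal_sup [set #|` S|%:R%:E | S in shatters C].

(* A (discrete) distribution over finite sets of hypotheses, given by its
   probability mass function. *)
Definition is_pmf (P : {fset hypothesis} -> R) : Prop :=
  (forall H, (0 <= P H)%R) /\
  \esum_(H in [set: {fset hypothesis}]) (P H)%:E = 1.

Definition prob_representation (C : set hypothesis) (alpha beta : R)
    (P : {fset hypothesis} -> R) : Prop :=
  is_pmf P /\
  forall c, C c -> forall D : probability X R,
    (1 - beta)%:E <= \esum_(H in [set H : {fset hypothesis} |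
        exists2 h, h \in H & D [set x | c x != h x] <= alpha%:E]) (P H)%:E.

(* The convention ln 0 = 0 applies to H = fset0. *)
Definition prob_size (P : {fset hypothesis} -> R) : \bar R :=
  ereal_sup [set (ln (#|` H|%:R : R))%:E | H in [set H | (0 < P H)%R]].

Definition PRDim (C : set hypothesis) : \bar R :=
  ereal_inf [set prob_size P | P in prob_representation C (1 / 4) (1 / 4)].

End learning.

Arguments VCdim {disp X} R C.

(* Main.v *)
Require Import Defs.
From HB Require Import structures.
From mathcomp Require Import all_boot all_order all_algebra finmap.
From mathcomp Require Import all_classical all_reals all_analysis measurable_realfun.
From mathcomp Require Import ring lra zify.

Set Implicit Arguments.
Unset Strict Implicit.
Unset Printing Implicit Defensive.
Import Order.TTheory GRing.Theory Num.Theory.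

Local Open Scope classical_set_scope.
Local Open Scope ring_scope.

(** A probabilistic representation of size [d] amounts to a finite prior on
    hypotheses giving mass about [exp(-d)] to the approximations of each concept
    (pick a random [H], then a uniform element of [H]).

    Upper bound. Boosting: the majority of [2k] independent draws from the prior
    is [(3/4)^k]-accurate with probability at least [exp(-O(d k))], so [M =
    exp(O(d log(1/alpha)))] such majorities contain a nearly optimal hypothesis.
    To select among them, each user compares two candidates by the difference of
    their empirical errors, clipped to [[-B, B]] with [B = alpha/2 +
    O(log(1/alpha)/sqrt m)]; by subgaussian concentration clipping biases the
    comparison by at most [alpha/16]. An exponential mechanism built on the soft
    maximum of the summed comparisons has sensitivity [2B], and a single
    exponential moment bounds its failure probability together with the sampling
    error.

    Lower bound. Group privacy turns the output law on any fixed dataset into a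
    prior of mass [exp(-eps n)/2], whence [d <= eps n + O(1)]. On a shattered
    set of size [k], let the labels agree with a sign vector [u] with
    probability [(1 + 32 alpha)/2]. The algorithm must land in a Hamming ball
    around [u], and such balls cover only a fraction [(3/5)^k] of the cube on
    average. Passing from the biased to the unbiased law costs a factor [1 +
    sqrt(chi2) (exp(eps) - 1)] per user by privacy, or a chi-square term over
    all [n m] samples without it; averaging over [u] gives both remaining terms. *)

(** * Integrals of bounded measurable functions *)

Section bounded_measurable.
Context (d : measure_display) (T : measurableType d) (R : realType).
Implicit Types f g : T -> R.

Definition bounded_measurable f :=
  measurable_fun [set: T] f /\ exists M : R, forall x, `|f x| <= M.

Lemma bounded_measurable_cst (c : R) : bounded_measurable (fun=> c).
Proof. by split; [exact: measurable_cst | exists `|c|]. Qed.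

Lemma bounded_measurableD f g :
  bounded_measurable f -> bounded_measurable g ->
  bounded_measurable (fun x => f x + g x).
Proof.
move=> [mf [M fM]] [mg [N gN]]; split; first exact: measurable_funD.
by exists (M + N) => x; rewrite (le_trans (ler_normD _ _))// lerD.
Qed.

Lemma bounded_measurableN f :
  bounded_measurable f -> bounded_measurable (fun x => - f x).
Proof.
move=> [mf [M fM]]; split; first exact: measurable_funN.
by exists M => x; rewrite normrN.
Qed.

Lemma bounded_measurableM f g :
  bounded_measurable f -> bounded_measurable g ->
  bounded_measurable (fun x => f x * g x).
Proof.
move=> [mf [M fM]] [mg [N gN]]; split; first exact: measurable_funM.
by exists (M * N) => x; rewrite normrM ler_pM.
Qed.

Lemma bounded_measurable_sum (I : Type) (s : seq I) (P : pred I) (F : I -> T -> R) :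
  (forall i, bounded_measurable (F i)) ->
  bounded_measurable (fun x => \sum_(i <- s | P i) F i x).
Proof.
move=> bF; under eq_fun do rewrite big_mkcond.
elim: s => [|i s IHs]; first by under eq_fun do rewrite big_nil; exact: bounded_measurable_cst.
under eq_fun do rewrite big_cons; apply: bounded_measurableD => //.
by case: (P i); [exact: bF | exact: bounded_measurable_cst].
Qed.

Lemma bounded_measurable_prod (I : Type) (s : seq I) (F : I -> T -> R) :
  (forall i, bounded_measurable (F i)) ->
  bounded_measurable (fun x => \prod_(i <- s) F i x).
Proof.
move=> bF; elim: s => [|i s IHs].
  by under eq_fun do rewrite big_nil; exact: bounded_measurable_cst.
by under eq_fun do rewrite big_cons; exact: bounded_measurableM.
Qed.

Lemma bounded_measurable_expR f :
  bounded_measurable f -> bounded_measurable (fun x => expR (f x)).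
Proof.
move=> [mf [M fM]]; split; first exact: measurableT_comp.
exists (expR M) => x; rewrite ger0_norm ?expR_ge0// ler_expR.
exact: le_trans (ler_norm _) (fM x).
Qed.

Lemma bounded_measurable_bool (b : T -> bool) :
  measurable_fun setT b -> bounded_measurable (fun x => (b x)%:R).
Proof.
move=> mb; split; first exact: (@measurableT_comp _ _ _ _ _ _ (fun b : bool => b%:R : R)).
by exists 1 => x; case: (b x); rewrite ?normr1 ?normr0.
Qed.

Lemma bounded_measurable_integrable (mu : {finite_measure set T -> \bar R}) f :
  bounded_measurable f -> mu.-integrable setT (EFin \o f).
Proof.
move=> [mf [M fM]]; apply: measurable_bounded_integrable => //.
  by rewrite ltey_eq fin_num_measure.
exists M; split; first exact: num_real.
by move=> y My x _; apply: le_trans (fM x) (ltW My).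
Qed.

End bounded_measurable.

Lemma bounded_measurable_comp (d d' : measure_display) (T : measurableType d)
    (T' : measurableType d') (R : realType) (phi : T' -> T) (f : T -> R) :
  measurable_fun setT phi -> bounded_measurable f -> bounded_measurable (fun x => f (phi x)).
Proof.
move=> mphi [mf [M fM]]; split; first exact: measurableT_comp.
by exists M.
Qed.

#[local] Hint Resolve bounded_measurable_cst bounded_measurableD
  bounded_measurableN bounded_measurableM bounded_measurable_sum
  bounded_measurable_prod bounded_measurable_expR : bounded_measurable.
#[local] Hint Extern 0 (bounded_measurable _) =>
  solve [auto 20 with bounded_measurable nocore] : core.
#[local] Hint Extern 0 (is_true (_.-integrable _ _)) =>
  solve [apply: bounded_measurable_integrable; auto 20 with bounded_measurable nocore] : core.

Section integrals_of_bounded_functions.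
Context (d : measure_display) (T : measurableType d) (R : realType).
Implicit Types (P : probability T R) (f : T -> R).

Lemma EFin_Rintegral P f :
  bounded_measurable f -> (\int[P]_x f x)%:E = (\int[P]_x (f x)%:E)%E.
Proof.
move=> bf; rewrite /Rintegral fineK//.
exact: (integrable_fin_num measurableT (bounded_measurable_integrable P bf)).
Qed.

Lemma Rintegral_probability_cst P (c : R) : \int[P]_x c = c.
Proof.
rewrite Rintegral_cst//.
by rewrite (_ : fine _ = 1) ?mulr1//; rewrite -[RHS]/(fine 1%E) -(probability_setT P).
Qed.

Lemma Rintegral_le_cst P f (c : R) :
  bounded_measurable f -> (forall x, f x <= c) -> \int[P]_x f x <= c.
Proof. by move=> bf fc; rewrite -[leRHS](Rintegral_probability_cst P); apply: le_Rintegral. Qed.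

Lemma Rintegral_ge_cst P f (c : R) :
  bounded_measurable f -> (forall x, c <= f x) -> c <= \int[P]_x f x.
Proof. by move=> bf fc; rewrite -[leLHS](Rintegral_probability_cst P); apply: le_Rintegral. Qed.

Lemma Rintegral_sum P (I : Type) (s : seq I) (F : I -> T -> R) :
  (forall i, bounded_measurable (F i)) ->
  \int[P]_x (\sum_(i <- s) F i x) = \sum_(i <- s) \int[P]_x F i x.
Proof.
move=> bF; elim: s => [|i s IHs].
  by rewrite big_nil; under eq_Rintegral do rewrite big_nil; rewrite Rintegral_probability_cst.
by rewrite big_cons -IHs -RintegralD//; apply: eq_Rintegral => x _; rewrite big_cons.
Qed.

Lemma Rintegral_bool P (b : T -> bool) : measurable_fun setT b ->
  (\int[P]_x (b x)%:R)%:E = P [set x | b x].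
Proof.
move=> mb; rewrite EFin_Rintegral; last exact: bounded_measurable_bool.
have mA : measurable [set x | b x].
  by rewrite -[X in measurable X]setTI; apply: (mb measurableT [set true]).
rewrite -[in RHS](setIT [set x | b x]) -(integral_indic P measurableT mA).
by apply: eq_integral => x _; rewrite indicE mem_setE.
Qed.

End integrals_of_bounded_functions.

Section product_integrals.
Context (d : measure_display) (T : measurableType d) (R : realType).
Implicit Types D : probability T R.

Lemma bounded_measurable_Rintegral (d' : measure_display) (T' : measurableType d')
    (P : probability T' R) (f : T * T' -> R) :
  bounded_measurable f -> bounded_measurable (fun x => \int[P]_y f (x, y)).
Proof.
move=> bf; have [mf [M fM]] := bf.
have bfx x : bounded_measurable (fun y => f (x, y)).
  by split; [exact: measurableT_comp | exists M => y].
split; last first.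
  exists M => x; rewrite ler_norml Rintegral_ge_cst ?Rintegral_le_cst// => y;
    by have := fM (x, y); rewrite ler_norml => /andP[].
have : measurable_fun setT (fubini_F P (EFin \o f)).
  pose D : probability T R := dirac point.
  pose DP : probability (T * T')%type R := (D \x P)%E.
  exact: (measurable_fubini_F (m1 := D) (bounded_measurable_integrable DP bf)).
by move=> mF; exact: (measurableT_comp (fine_measurable measurableT) mF).
Qed.

Lemma Rintegral_product (d' : measure_display) (T' : measurableType d')
    D (P : probability T' R) (f : T * T' -> R) :
  bounded_measurable f ->
  \int[(D \x P)%E]_z f z = \int[D]_x \int[P]_y f (x, y).
Proof.
move=> bf; have [mf _] := bf.
have bfx x : bounded_measurable (fun y => f (x, y)).
  exact: (bounded_measurable_comp (measurable_pair1 x) bf).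
apply: EFin_inj; rewrite !EFin_Rintegral//; last exact: bounded_measurable_Rintegral.
pose DP : probability (T * T')%type R := (D \x P)%E.
rewrite -(integral12_prod_meas1 (bounded_measurable_integrable DP bf)).
by apply: eq_integral => x _; rewrite EFin_Rintegral.
Qed.

Lemma Rintegral_distribution (d' : measure_display) (T' : measurableType d')
    D (X : {mfun T >-> T'}) (f : T' -> R) :
  bounded_measurable f -> \int[distribution D X]_y f y = \int[D]_x f (X x).
Proof.
move=> bf; rewrite /Rintegral integral_distribution//.
  by apply/measurable_EFinP; case: bf.
exact/bounded_measurable_integrable/bounded_measurable_comp.
Qed.

End product_integrals.

Section iid_integrals.
Context (d : measure_display) (T : measurableType d) (R : realType).
Implicit Types D : probability T R.

Lemma Rintegral_iid0 D (f : 0.-tuple T -> R) :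
  bounded_measurable f -> \int[iid D 0]_t f t = f [tuple].
Proof.
move=> [mf _]; rewrite /Rintegral integral_dirac ?diracT ?mul1e//.
exact/measurable_EFinP.
Qed.

Lemma bounded_measurable_cons n (f : n.+1.-tuple T -> R) (x : T) :
  bounded_measurable f -> bounded_measurable (fun t : n.-tuple T => f [tuple of x :: t]).
Proof.
apply: (bounded_measurable_comp (phi := fun t : n.-tuple T => [tuple of x :: t])).
exact: measurable_cons.
Qed.

Lemma bounded_measurable_Rintegral_cons D n (f : n.+1.-tuple T -> R) :
  bounded_measurable f ->
  bounded_measurable (fun x => \int[iid D n]_t f [tuple of x :: t]).
Proof.
move=> bf; apply: (bounded_measurable_Rintegral (iid D n) (f := fun z => f (tcons z))).
exact: (bounded_measurable_comp (@measurable_tcons _ _ n) bf).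
Qed.

Lemma Rintegral_iidS D n (f : n.+1.-tuple T -> R) : bounded_measurable f ->
  \int[iid D n.+1]_t f t = \int[D]_x \int[iid D n]_t f [tuple of x :: t].
Proof.
move=> bf.
have bft : bounded_measurable (fun z : T * n.-tuple T => f (tcons z)).
  exact: (bounded_measurable_comp (@measurable_tcons _ _ n) bf).
rewrite -(Rintegral_product D (iid D n) bft).
exact: (Rintegral_distribution (D \x iid D n)%E (@tcons _ T n) bf).
Qed.

Lemma bounded_measurable_tnth n (f : T -> R) (i : 'I_n) :
  bounded_measurable f -> bounded_measurable (fun t : n.-tuple T => f (tnth t i)).
Proof. exact: (bounded_measurable_comp (measurable_tnth i)). Qed.

Lemma bounded_measurable_tuple_sum n (f : T -> R) :
  bounded_measurable f -> bounded_measurable (fun t : n.-tuple T => \sum_(x <- t) f x).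
Proof.
move=> bf; under eq_fun do rewrite big_tuple.
by apply: bounded_measurable_sum => i; exact: bounded_measurable_tnth.
Qed.

Lemma bounded_measurable_tuple_prod n (f : T -> R) :
  bounded_measurable f -> bounded_measurable (fun t : n.-tuple T => \prod_(x <- t) f x).
Proof.
move=> bf; under eq_fun do rewrite big_tuple.
by apply: bounded_measurable_prod => i; exact: bounded_measurable_tnth.
Qed.

End iid_integrals.

#[local] Hint Extern 1 (bounded_measurable _) =>
  first [apply: bounded_measurable_tuple_sum | apply: bounded_measurable_tuple_prod]
  : bounded_measurable.

Section iid_sums_and_products.
Context (d : measure_display) (T : measurableType d) (R : realType).
Implicit Types (D : probability T R) (f : T -> R).

Lemma Rintegral_iid_prod D n f : bounded_measurable f ->
  \int[iid D n]_t (\prod_(x <- t) f x) = (\int[D]_x f x) ^+ n.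
Proof.
move=> bf; elim: n => [|n IHn]; first by rewrite Rintegral_iid0 ?big_nil.
rewrite Rintegral_iidS// exprS -IHn -RintegralZr//.
apply: eq_Rintegral => x _; rewrite -RintegralZl//.
by apply: eq_Rintegral => t _; rewrite big_cons.
Qed.

Lemma Rintegral_iid_sum D n f : bounded_measurable f ->
  \int[iid D n]_t (\sum_(x <- t) f x) = n%:R * \int[D]_x f x.
Proof.
move=> bf; elim: n => [|n IHn]; first by rewrite Rintegral_iid0 ?big_nil ?mul0r.
rewrite Rintegral_iidS// -nat1r mulrDl mul1r -IHn.
rewrite -[X in _ = _ + X](Rintegral_probability_cst D) -RintegralD//.
apply: eq_Rintegral => x _.
rewrite -[f x in RHS](Rintegral_probability_cst (iid D n)) -RintegralD//.
by apply: eq_Rintegral => t _; rewrite big_cons.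
Qed.

End iid_sums_and_products.

(** * Reweighted and finitely supported laws *)

Lemma density_law (d : measure_display) (T : measurableType d) (R : realType)
    (D : probability T R) (w : T -> R) :
  bounded_measurable w -> (forall x, 0 <= w x) -> \int[D]_x w x = 1 ->
  exists D' : probability T R, forall f, bounded_measurable f ->
    \int[D']_x f x = \int[D]_x (f x * w x).
Proof.
move=> bw w_ge0 w_mass.
have [mw _] := bw; have mEw := (measurable_EFinP setT w).2 mw.
have w_int : D.-integrable setT (EFin \o w) by [].
have w_measure_ge0 A : (0 <= induced_charge w_int A)%E.
  by apply: integral_ge0 => x _; rewrite lee_fin.
pose nu := measure_of_charge _ w_measure_ge0.
have nu_mass : nu setT = 1%E by rewrite -[LHS]EFin_Rintegral// w_mass.
pose D' : probability T R := HB.pack nu (Measure_isProbability.Build _ _ _ nu nu_mass).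
have D'_dom : D' `<< D.
  apply/null_content_dominatesP => A mA DA0.
  by apply: null_set_integral => //; exact: measurable_funTS.
exists D' => f bf; have [mf _] := bf; have mEf := (measurable_EFinP setT f).2 mf.
apply: EFin_inj; rewrite !EFin_Rintegral//.
rewrite -(Radon_Nikodym_change_of_variables D'_dom)//.
have mRN := measurable_int _ (Radon_Nikodym_integrable D'_dom).
apply: ae_eq_integral => //.
- exact: emeasurable_funM.
- by apply/measurable_EFinP; exact: measurable_funM.
apply: (ae_eqe_mul2l (g := EFin \o w) (EFin \o f)); apply: integral_ae_eq => //.
  exact: Radon_Nikodym_integrable.
by move=> A _ mA; rewrite -Radon_Nikodym_integral.
Qed.

Lemma sumr_const_mull (R : pzSemiRingType) (I : finType) (c : R) :
  \sum_(i : I) c = #|I|%:R * c.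
Proof. by rewrite sumr_const mulr_natl. Qed.

Section finite_pmf.
Context (R : realType) (I : finType).
Implicit Types p f : I -> R.

Definition finite_pmf p := (forall i, 0 <= p i) /\ \sum_i p i = 1.

Lemma finite_pmf_event_le1 p (E : pred I) : finite_pmf p -> \sum_(i | E i) p i <= 1.
Proof. by move=> [p_ge0 <-]; rewrite [leRHS](bigID E)/= lerDl sumr_ge0. Qed.

Lemma finite_pmf_le1 p i : finite_pmf p -> p i <= 1.
Proof. by move=> pmf_p; have := finite_pmf_event_le1 (pred1 i) pmf_p; rewrite big_pred1_eq. Qed.

Lemma finite_pmf_event_le p (E F : pred I) : finite_pmf p -> (forall i, E i -> F i) ->
  \sum_(i | E i) p i <= \sum_(i | F i) p i.
Proof.
move=> [p_ge0 _] EF; rewrite big_mkcond [leRHS]big_mkcond; apply: ler_sum => i _.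
by case: ifPn => [/EF ->//|_]; case: ifP.
Qed.

Lemma finite_pmf_mean_le p f (c : R) :
  finite_pmf p -> (forall i, f i <= c) -> \sum_i p i * f i <= c.
Proof.
move=> [p_ge0 p_mass] f_le; rewrite -[leRHS]mul1r -p_mass mulr_suml.
by apply: ler_sum => i _; exact: ler_wpM2l.
Qed.

Lemma finite_pmf_mean_ge p f (c : R) :
  finite_pmf p -> (forall i, c <= f i) -> c <= \sum_i p i * f i.
Proof.
move=> [p_ge0 p_mass] f_ge; rewrite -[leLHS]mul1r -p_mass mulr_suml.
by apply: ler_sum => i _; exact: ler_wpM2l.
Qed.

Lemma finite_pmf_inhabited p : finite_pmf p -> inhabited I.
Proof.
move=> [_ p_mass]; apply: contrapT => I_empty; move/eqP: p_mass.
by rewrite big1 1?eq_sym ?oner_eq0// => i; case: I_empty.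
Qed.

End finite_pmf.

Definition tuple_pmf (R : realType) (I : finType) n (p : I -> R) (t : n.-tuple I) : R :=
  \prod_(i <- t) p i.
Arguments tuple_pmf {R I} n p t.

Section tuple_pmf.
Context (R : realType) (I : finType).
Implicit Types p : I -> R.

Lemma sum_tuple0 (F : 0.-tuple I -> R) : \sum_t F t = F [tuple].
Proof. by rewrite (big_pred1 [tuple])// => t /=; rewrite [t]tuple0. Qed.

Lemma sum_tupleS n (F : n.+1.-tuple I -> R) :
  \sum_t F t = \sum_i \sum_(t : n.-tuple I) F [tuple of i :: t].
Proof.
rewrite pair_big /= (reindex (fun z : I * n.-tuple I => [tuple of z.1 :: z.2]))//=.
exists (fun t : n.+1.-tuple I => (thead t, [tuple of behead t])) => [[i t] _|t _] /=.
  by congr pair; apply: val_inj.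
by rewrite -tuple_eta.
Qed.

Lemma tuple_pmf0 p (t : 0.-tuple I) : tuple_pmf 0 p t = 1.
Proof. by rewrite /tuple_pmf tuple0 big_nil. Qed.

Lemma tuple_pmf_cons p n i (t : n.-tuple I) :
  tuple_pmf n.+1 p [tuple of i :: t] = p i * tuple_pmf n p t.
Proof. by rewrite /tuple_pmf big_cons. Qed.

Lemma tuple_pmf_ge0 p n (t : n.-tuple I) : (forall i, 0 <= p i) -> 0 <= tuple_pmf n p t.
Proof. by move=> p_ge0; apply: prodr_ge0. Qed.

Lemma tuple_pmf_gt0 p n (t : n.-tuple I) : (forall i, 0 < p i) -> 0 < tuple_pmf n p t.
Proof. by move=> p_gt0; apply: prodr_gt0. Qed.

Lemma sum_tuple_pmf p n : \sum_(t : n.-tuple I) tuple_pmf n p t = (\sum_i p i) ^+ n.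
Proof.
elim: n => [|n IHn]; first by rewrite sum_tuple0 tuple_pmf0.
rewrite sum_tupleS exprS mulr_suml; apply: eq_bigr => i _.
by rewrite -IHn mulr_sumr; apply: eq_bigr => t _; rewrite tuple_pmf_cons.
Qed.

Lemma finite_pmf_tuple p n : finite_pmf p -> finite_pmf (tuple_pmf n p).
Proof.
move=> [p_ge0 p_mass]; split; first by move=> t; exact: tuple_pmf_ge0.
by rewrite sum_tuple_pmf p_mass expr1n.
Qed.

Lemma tuple_pmf_all p n (E : pred I) :
  \sum_(t : n.-tuple I | all E t) tuple_pmf n p t = (\sum_(i | E i) p i) ^+ n.
Proof.
pose pE i := if E i then p i else 0.
rewrite (big_mkcond E) -sum_tuple_pmf big_mkcond/=; apply: eq_bigr => t _.
rewrite /tuple_pmf; case: ifPn => [/allP tE|/allPn[i it /negbTE Ei]].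
  by rewrite !big_seq; apply: eq_bigr => i /tE; rewrite /pE => ->.
by rewrite (big_rem i it)/= Ei mul0r.
Qed.

Lemma tuple_pmf_has p n (E : pred I) : finite_pmf p ->
  \sum_(t : n.-tuple I | has E t) tuple_pmf n p t = 1 - (1 - \sum_(i | E i) p i) ^+ n.
Proof.
move=> pmf_p; have [_ p_mass] := pmf_p.
have [_ tuple_mass] := finite_pmf_tuple n pmf_p.
have -> : 1 - \sum_(i | E i) p i = \sum_(i | predC E i) p i.
  by rewrite -p_mass (bigID E)/= addrAC subrr add0r.
rewrite -tuple_pmf_all -tuple_mass [in RHS](bigID (fun t : n.-tuple I => has E t))/=.
rewrite [X in _ + X - _](eq_bigl (fun t : n.-tuple I => all (predC E) t)) ?addrK// => t.
by rewrite all_predC.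
Qed.

End tuple_pmf.

Section discrete_law.
Context (d : measure_display) (T : measurableType d) (R : realType).
Implicit Types D : probability T R.

Definition discrete_law D (I : finType) (p : I -> R) (g : I -> T) :=
  forall f, bounded_measurable f -> \int[D]_x f x = \sum_i p i * f (g i).

Lemma discrete_law_exists (I : finType) (p : I -> R) (g : I -> T) :
  finite_pmf p -> exists D, discrete_law D p g.
Proof.
move=> pmf_p; have [i0] := finite_pmf_inhabited pmf_p; have [p_ge0 p_mass] := pmf_p.
pose atom k := mscale (NngNum (p_ge0 (nth i0 (enum I) k))) \d_(g (nth i0 (enum I) k)).
pose mu := msum atom (size (enum I)).
have mu_integral (f : T -> R) : measurable_fun setT f -> (forall x, 0 <= f x) ->
    (\int[mu]_x (f x)%:E = (\sum_i p i * f (g i))%:E)%E.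
  move=> mf f_ge0; have mEf := (measurable_EFinP setT f).2 mf.
  rewrite ge0_integral_measure_sum//=; last by move=> x _; rewrite lee_fin.
  rewrite -(big_enum _ _ _ (fun i => p i * f (g i)))/= (big_nth i0) big_mkord -sumEFin.
  apply: eq_bigr => k _; rewrite ge0_integral_mscale//=; last by move=> x _; rewrite lee_fin.
  by rewrite integral_dirac// diracT mul1e.
have mu_mass : mu setT = 1%E.
  rewrite -[LHS]mul1e -integral_cst// mu_integral//.
  by under eq_bigr do rewrite mulr1; rewrite p_mass.
pose D : probability T R := HB.pack mu (Measure_isProbability.Build _ _ _ mu mu_mass).
exists D => f bf; have [mf [M f_le]] := bf.
have fM_ge0 x : 0 <= f x + M by have := f_le x; rewrite ler_norml => /andP[+ _]; lra.
have : \int[D]_x (f x + M) = \sum_i p i * (f (g i) + M).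
  apply: EFin_inj; rewrite EFin_Rintegral// mu_integral//.
  by apply: measurable_funD => //; exact: measurable_cst.
rewrite RintegralD// Rintegral_probability_cst.
under eq_bigr do rewrite mulrDr.
by rewrite big_split/= -mulr_suml p_mass mul1r => /addIr.
Qed.

End discrete_law.

Lemma discrete_law_iid (d : measure_display) (T : measurableType d) (R : realType)
    (D : probability T R) (I : finType) (p : I -> R) (g : I -> T) n :
  discrete_law D p g -> discrete_law (iid D n) (tuple_pmf n p) (fun t => map_tuple g t).
Proof.
move=> D_law; elim: n => [|n IHn] f bf.
  rewrite Rintegral_iid0// sum_tuple0 tuple_pmf0 mul1r; congr f; exact: val_inj.
rewrite Rintegral_iidS// D_law; last exact: bounded_measurable_Rintegral_cons.
rewrite sum_tupleS; apply: eq_bigr => i _.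
rewrite IHn; last exact: bounded_measurable_cons.
rewrite mulr_sumr; apply: eq_bigr => t _; rewrite tuple_pmf_cons mulrA.
by congr (_ * f _); exact: val_inj.
Qed.

(** * Change of measure *)

Section chi2.
Context (R : realType) (J : finType).
Implicit Types w x y mu nu f : J -> R.

Lemma weighted_cauchy_schwarz w x y : (forall j, 0 <= w j) ->
  (\sum_j w j * (x j * y j)) ^+ 2 <=
  (\sum_j w j * x j ^+ 2) * \sum_j w j * y j ^+ 2.
Proof.
move=> w_ge0.
have lagrange_ge0 : 0 <= \sum_i \sum_j w i * w j * (x i * y j - x j * y i) ^+ 2.
  apply: sumr_ge0 => i _; apply: sumr_ge0 => j _.
  by rewrite mulr_ge0 ?sqr_ge0 ?mulr_ge0.
have expand i j : w i * w j * (x i * y j - x j * y i) ^+ 2 =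
    w i * x i ^+ 2 * (w j * y j ^+ 2) + w i * y i ^+ 2 * (w j * x j ^+ 2)
    - 2 * (w i * (x i * y i) * (w j * (x j * y j))) by ring.
move: lagrange_ge0.
under eq_bigr => i do under eq_bigr => j do rewrite expand.
under eq_bigr do rewrite sumrB big_split/= -!mulr_sumr.
rewrite sumrB big_split/= -!mulr_suml -mulr_sumr -mulr_suml; lra.
Qed.

Definition chi2 mu nu := \sum_j (mu j - nu j) ^+ 2 / nu j.

Lemma chi2E mu nu : (forall j, 0 < nu j) -> \sum_j mu j = 1 -> \sum_j nu j = 1 ->
  chi2 mu nu = \sum_j mu j ^+ 2 / nu j - 1.
Proof.
move=> nu_gt0 mu_mass nu_mass.
have expand j : (mu j - nu j) ^+ 2 / nu j = mu j ^+ 2 / nu j - 2 * mu j + nu j.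
  by field; rewrite gt_eqF.
rewrite /chi2; under eq_bigr do rewrite expand.
by rewrite big_split sumrB/= -mulr_sumr mu_mass nu_mass; lra.
Qed.

Lemma chi2_mean_sub_sqr mu nu f : (forall j, 0 < nu j) ->
  (\sum_j (mu j - nu j) * f j) ^+ 2 <= chi2 mu nu * \sum_j nu j * f j ^+ 2.
Proof.
move=> nu_gt0; pose rel j := (mu j - nu j) / nu j.
have nuN0 j : nu j != 0 by rewrite gt_eqF.
have -> : \sum_j (mu j - nu j) * f j = \sum_j nu j * (rel j * f j).
  by apply: eq_bigr => j _; rewrite /rel; field.
have -> : chi2 mu nu = \sum_j nu j * rel j ^+ 2.
  by apply: eq_bigr => j _; rewrite /rel; field.
by apply: weighted_cauchy_schwarz => j; exact: ltW.
Qed.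

Lemma mean_le_ratio_mean mu nu f (c : R) : finite_pmf mu -> finite_pmf nu ->
  (forall i j, f i <= c * f j) -> \sum_j mu j * f j <= c * \sum_j nu j * f j.
Proof.
move=> pmf_mu pmf_nu f_ratio; apply: finite_pmf_mean_le => // i.
rewrite mulr_sumr; under eq_bigr do rewrite mulrCA.
exact: finite_pmf_mean_ge.
Qed.

(* Center f at its nu-mean, from which it deviates by at most c - 1 times that mean. *)
Lemma mean_le_chi2_mean mu nu f (c s : R) :
  (forall j, 0 < nu j) -> finite_pmf nu -> \sum_j mu j = 1 ->
  1 <= c -> 0 <= s -> chi2 mu nu <= s ^+ 2 ->
  (forall j, 0 <= f j) -> (forall i j, f i <= c * f j) ->
  \sum_j mu j * f j <= (1 + s * (c - 1)) * \sum_j nu j * f j.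
Proof.
move=> nu_gt0 pmf_nu mu_mass c_ge1 s_ge0 chi2_le f_ge0 f_ratio.
have [nu_ge0 nu_mass] := pmf_nu; set m := \sum_j nu j * f j.
have m_ge0 : 0 <= m by apply: sumr_ge0 => j _; rewrite mulr_ge0.
have f_le_mean i : f i <= c * m.
  rewrite /m mulr_sumr; under eq_bigr do rewrite mulrCA.
  exact: finite_pmf_mean_ge.
have mean_le_f i : m <= c * f i by exact: finite_pmf_mean_le.
have deviation_sqr j : (f j - m) ^+ 2 <= ((c - 1) * m) ^+ 2.
  have cm_ge0 : 0 <= (c - 1) * m by rewrite mulr_ge0 ?subr_ge0.
  rewrite -[leLHS]real_normK ?num_real// lerXn2r ?nnegrE// ler_norml.
  by have := f_le_mean j; have := mean_le_f j; have := f_ge0 j; nra.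
have centered : \sum_j (mu j - nu j) * (f j - m) = \sum_j mu j * f j - m.
  under eq_bigr do rewrite mulrBr mulrBl.
  by rewrite !sumrB -mulr_suml sumrB nu_mass mu_mass subrr mul0r subr0.
have : (\sum_j mu j * f j - m) ^+ 2 <= (s * ((c - 1) * m)) ^+ 2.
  rewrite -centered (le_trans (chi2_mean_sub_sqr _ _ nu_gt0))// exprMn ler_pM//.
  - by apply: sumr_ge0 => j _; rewrite divr_ge0 ?sqr_ge0.
  - by apply: sumr_ge0 => j _; rewrite mulr_ge0 ?sqr_ge0.
  - exact: finite_pmf_mean_le.
have sm_ge0 : 0 <= s * ((c - 1) * m) by rewrite !mulr_ge0 ?subr_ge0.
rewrite -ler_sqrt ?sqr_ge0// !sqrtr_sqr (ger0_norm sm_ge0) => /(le_trans (ler_norm _)).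
lra.
Qed.

End chi2.

Section tensorization.
Context (R : realType) (J : finType).

Definition adjacent n (t t' : n.-tuple J) :=
  exists i : 'I_n, forall j, j != i -> tnth t j = tnth t' j.

Lemma adjacent_head n i j (t : n.-tuple J) : adjacent [tuple of i :: t] [tuple of j :: t].
Proof.
by exists ord0 => k; have [k' ->|->] := unliftP ord0 k; rewrite ?eqxx// !tnthS.
Qed.

Lemma adjacent_cons n i (t t' : n.-tuple J) :
  adjacent t t' -> adjacent [tuple of i :: t] [tuple of i :: t'].
Proof.
move=> [k tt']; exists (lift ord0 k) => j.
have [j' ->|->//] := unliftP ord0 j.
by rewrite (inj_eq lift_inj) !tnthS; exact: tt'.
Qed.

Lemma tuple_mean_le_ratio (mu nu : J -> R) (c rho : R) n (F : n.-tuple J -> R) :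
  (forall j, 0 <= nu j) -> (forall j, 0 <= mu j) -> 0 <= rho ->
  (forall f : J -> R, (forall j, 0 <= f j) -> (forall i j, f i <= c * f j) ->
     \sum_j mu j * f j <= rho * \sum_j nu j * f j) ->
  (forall t, 0 <= F t) ->
  (forall t t', adjacent t t' -> F t <= c * F t') ->
  \sum_t tuple_pmf n mu t * F t <= rho ^+ n * \sum_t tuple_pmf n nu t * F t.
Proof.
move=> nu_ge0 mu_ge0 rho_ge0 one_coordinate.
elim: n F => [|n IHn] F F_ge0 F_ratio.
  by rewrite !sum_tuple0 !tuple_pmf0 expr0 !mul1r.
have split_head p : \sum_t tuple_pmf n.+1 p t * F t =
    \sum_i p i * \sum_(t : n.-tuple J) tuple_pmf n p t * F [tuple of i :: t].
  rewrite sum_tupleS; apply: eq_bigr => i _; rewrite mulr_sumr.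
  by apply: eq_bigr => t _; rewrite tuple_pmf_cons mulrA.
have swap p q : \sum_i p i * (\sum_(t : n.-tuple J) tuple_pmf n q t * F [tuple of i :: t]) =
    \sum_(t : n.-tuple J) tuple_pmf n q t * \sum_i p i * F [tuple of i :: t].
  under eq_bigr do rewrite mulr_sumr; rewrite exchange_big/=.
  apply: eq_bigr => t _; rewrite mulr_sumr.
  by apply: eq_bigr => i _; rewrite mulrCA.
apply: (@le_trans _ _ (\sum_i mu i *
    (rho ^+ n * \sum_(t : n.-tuple J) tuple_pmf n nu t * F [tuple of i :: t]))).
  rewrite split_head; apply: ler_sum => i _; rewrite ler_wpM2l// IHn// => t t' tt'.
  exact/F_ratio/adjacent_cons.
under eq_bigr do rewrite mulrCA.
rewrite -mulr_sumr swap split_head swap exprSr -mulrA ler_wpM2l ?exprn_ge0// mulr_sumr.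
apply: ler_sum => t _; rewrite [leRHS]mulrCA ler_wpM2l ?tuple_pmf_ge0// one_coordinate// => i j.
exact/F_ratio/adjacent_head.
Qed.

Lemma chi2_tuple (mu nu : J -> R) n : (forall j, 0 < nu j) ->
  \sum_j mu j = 1 -> \sum_j nu j = 1 ->
  chi2 (tuple_pmf n mu) (tuple_pmf n nu) = (1 + chi2 mu nu) ^+ n - 1.
Proof.
move=> nu_gt0 mu_mass nu_mass.
rewrite !chi2E ?sum_tuple_pmf ?mu_mass ?nu_mass ?expr1n//; last by move=> t; exact: tuple_pmf_gt0.
rewrite [1 + _]addrC subrK -sum_tuple_pmf; congr (_ - _); apply: eq_bigr => t _.
by rewrite /tuple_pmf -prodrXl -prodf_div.
Qed.

End tensorization.

Section hamming.
Context (R : realType) (k : nat).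
Implicit Types u v : 'I_k -> bool.

Definition hamming u v : nat := #|[pred i | u i != v i]|.

Lemma eq_hamming0 u v : v =1 u -> hamming u v = 0%N.
Proof. by move=> vu; apply: eq_card0 => i; rewrite !inE vu eqxx. Qed.

Lemma sum_hamming_pow (s : R) v :
  \sum_(u : {ffun 'I_k -> bool}) s ^+ hamming u v = (1 + s) ^+ k.
Proof.
transitivity (\prod_(i < k) \sum_(b : bool) (if b != v i then s else 1)).
  rewrite bigA_distr_bigA/=; apply: eq_bigr => u _.
  by rewrite -big_mkcond/= prodr_const.
rewrite (eq_bigr (fun=> 1 + s)) ?prodr_const ?card_ord// => i _.
by rewrite big_bool; case: (v i); rewrite //= addrC.
Qed.

Lemma hamming_ball_le (q : nat) (r : R) v : 0 < r <= 1 ->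
  (\sum_(u : {ffun 'I_k -> bool}) (q * hamming u v <= k)%N%:R) * r ^+ k <= (1 + r ^+ q) ^+ k.
Proof.
move=> /andP[r_gt0 r_le1]; rewrite -(sum_hamming_pow _ v) mulr_suml.
apply: ler_sum => u _; rewrite -exprM.
case: leqP => [near_v|_]; last by rewrite mul0r exprn_ge0// ltW.
by rewrite mul1r; apply: ler_wiXn2l => //; exact: ltW.
Qed.

Lemma nine_tenths_expr32_le : (9 / 10 : R) ^+ 32 <= 1 / 20.
Proof.
have sqr_le (x y z : R) : 0 <= x <= y -> y ^+ 2 <= z -> 0 <= x ^+ 2 <= z.
  by move=> /andP[x_ge0 xy] yz; rewrite sqr_ge0 (le_trans _ yz)// lerXn2r// nnegrE (le_trans x_ge0).
have exp4 : 0 <= (9 / 10 : R) ^+ 4 <= 66 / 100.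
  by rewrite (exprM _ 2 2); apply: (sqr_le _ (81 / 100)); lra.
have exp16 : 0 <= (9 / 10 : R) ^+ 16 <= 2 / 10.
  rewrite (exprM _ 4 4) (exprM _ 2 2); apply: (sqr_le _ (44 / 100)); last lra.
  by apply: (sqr_le _ _ _ exp4); lra.
by rewrite (exprM _ 16 2); have /andP[_ ->//] := sqr_le _ _ (1 / 20) exp16 ltac:(lra).
Qed.

Lemma hamming_ball32_le v :
  \sum_(u : {ffun 'I_k -> bool}) (32 * hamming u v <= k)%N%:R <= (6 / 5 : R) ^+ k.
Proof.
have r_gt0 : 0 < 9 / 10 :> R by lra.
rewrite -(ler_pM2r (exprn_gt0 k r_gt0)).
apply: le_trans (hamming_ball_le 32 v _) _; first by rewrite r_gt0; lra.
have pow_le := nine_tenths_expr32_le; have pow_gt0 := exprn_gt0 32 r_gt0.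
by rewrite -exprMn lerXn2r// ?nnegrE; lra.
Qed.

End hamming.

(** * Elementary bounds *)

Section exponential_bounds.
Context (R : realType).
Implicit Types x y : R.

Lemma expR_le_inv_onem x : x < 1 -> expR x <= (1 - x)^-1.
Proof.
move=> x_lt1; rewrite -[leLHS]invrK -expRN lef_pV2 ?posrE ?subr_gt0 ?expR_gt0//.
exact: expR_ge1Dx.
Qed.

Lemma expR_le1D2x x : 0 <= x <= 1 / 2 -> expR x <= 1 + 2 * x.
Proof.
move=> /andP[x_ge0 x_le]; have x_lt1 : x < 1 by lra.
by rewrite (le_trans (expR_le_inv_onem x_lt1))// -[leLHS]mul1r ler_pdivrMr ?subr_gt0//; nra.
Qed.

Lemma expR_le1DxDsqr x : x <= 1 / 3 -> expR x <= 1 + x + x ^+ 2.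
Proof.
move=> x_le; have half_lt1 : x / 2 < 1 by lra.
have -> : expR x = expR (x / 2) ^+ 2 by rewrite -expRM_natr; congr expR; field.
apply: (@le_trans _ _ ((1 - x / 2) ^- 2)).
  rewrite -exprVn lerXn2r ?nnegrE ?expR_ge0 ?invr_ge0 ?subr_ge0 ?(ltW half_lt1)//.
  exact: expR_le_inv_onem.
rewrite -[leLHS]mul1r ler_pdivrMr ?exprn_gt0 ?subr_gt0// -subr_ge0.
rewrite (_ : _ - 1 = x ^+ 2 / 4 * (1 - 3 * x + x ^+ 2)); last by field.
by rewrite mulr_ge0 ?divr_ge0 ?sqr_ge0//; have := sqr_ge0 x; lra.
Qed.

Lemma exprn1D_le_expR x n : -1 <= x -> (1 + x) ^+ n <= expR (x * n%:R).
Proof.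
move=> x_ge; rewrite expRM_natr lerXn2r ?nnegrE ?expR_ge0 ?expR_ge1Dx//.
by lra.
Qed.

Lemma exprnB_le_expRN x n : x <= 1 -> (1 - x) ^+ n <= expR (- (x * n%:R)).
Proof. by move=> x_le1; rewrite -mulNr exprn1D_le_expR// lerN2. Qed.

Lemma exprnB_le_expRN_div x c n : 0 < x <= 1 -> c / x <= n%:R -> (1 - x) ^+ n <= expR (- c).
Proof.
move=> /andP[x_gt0 x_le1]; rewrite ler_pdivrMr// mulrC => c_le.
by rewrite (le_trans (exprnB_le_expRN _ x_le1))// ler_expR lerN2.
Qed.

Lemma expRM_natr_le_exprn x y n : x < 1 -> 1 <= y * (1 - x) -> expR (x * n%:R) <= y ^+ n.
Proof.
move=> x_lt1; rewrite -ler_pdivrMr ?subr_gt0// mul1r => y_ge.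
have exp_le := le_trans (expR_le_inv_onem x_lt1) y_ge.
by rewrite expRM_natr lerXn2r ?nnegrE ?expR_ge0// (le_trans (expR_ge0 x)).
Qed.

Lemma expR1_le4 : expR 1 <= 4 :> R.
Proof.
have := @expRM_natr_le_exprn 2^-1 2 2; rewrite mulVf ?pnatr_eq0// -natrX.
by apply; lra.
Qed.

Lemma expR2_ge5 : 5 <= expR 2 :> R.
Proof.
have sqr_ge : 9 / 4 <= expR (1 / 2) ^+ 2 :> R by have := expR_ge1Dx (1 / 2 : R); nra.
have -> : expR 2 = expR (1 / 2) ^+ 4 :> R by rewrite -expRM_natr; congr expR; field.
by rewrite (exprM _ 2 2); nra.
Qed.

Lemma expRN2_le : expR (- 2) <= 1 / 5 :> R.
Proof.
by rewrite expRN -[leLHS]mul1r ler_pdivrMr ?expR_gt0//; have := expR2_ge5; lra.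
Qed.

Lemma expRN4_le : expR (- 4) <= 1 / 25 :> R.
Proof.
have -> : - 4 = - 2 * 2%:R :> R by ring.
by rewrite expRM_natr; have := expRN2_le; have := expR_ge0 (- 2 : R); nra.
Qed.

End exponential_bounds.

Section rounding_and_logarithms.
Context (R : realType).

Lemma exists_natr_itvcc (y : R) : 0 <= y -> exists2 n : nat, (0 < n)%N & y <= n%:R <= y + 1.
Proof.
move=> y_ge0; have /andP[trunc_le lt_trunc] := truncn_itv y_ge0.
by exists (Num.trunc y).+1 => //; rewrite (ltW lt_trunc) -natr1 lerD2r.
Qed.

Lemma ler_ln_gt0 (x y : R) : 0 < x -> x <= y -> ln x <= ln y.
Proof. by move=> x_gt0 xy; rewrite ler_ln ?posrE// (lt_le_trans x_gt0). Qed.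

Lemma ler_ln_nat (m n : nat) : (m <= n)%N -> ln (m%:R : R) <= ln (n%:R : R).
Proof.
case: m => [_|m mn]; last by rewrite ler_ln_gt0 ?ltr0n ?ler_nat.
by rewrite ln0//; case: n => [|n]; [rewrite ln0 | rewrite ln_ge0// ler1n].
Qed.

End rounding_and_logarithms.

(** * Errors of hypotheses *)

Lemma measurable_neqb (d : measure_display) (T : measurableType d) (b c : T -> bool) :
  measurable_fun setT b -> measurable_fun setT c ->
  measurable_fun setT (fun x => b x != c x).
Proof.
move=> mb mc; rewrite (_ : (fun x => _) = fun x => (b x && ~~ c x) || (~~ b x && c x)).
  by apply: measurable_or; apply: measurable_and => //; exact: measurable_neg.
by apply/funext => x; case: (b x); case: (c x).
Qed.

Section errors.
Context (disp : measure_display) (X : measurableType disp) (R : realType).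
Implicit Types (c h : hypothesis X) (D : probability (X * bool)%type R)
  (DX : probability X R).

Definition miss h (z : X * bool) : R := (h z.1 != z.2)%:R.
Definition differ c h (x : X) : R := (c x != h x)%:R.
Definition err D h : R := \int[D]_z miss h z.
Definition disagreement DX c h : R := \int[DX]_x differ c h x.

Lemma measurable_miss h : measurable_fun setT (fun z : X * bool => h z.1 != z.2).
Proof. by apply: measurable_neqb => //; exact: measurableT_comp. Qed.

Lemma bounded_measurable_miss h : bounded_measurable (miss h).
Proof. exact: (bounded_measurable_bool R (measurable_miss h)). Qed.

Lemma measurable_differ c h : measurable_fun setT (fun x : X => c x != h x).
Proof. exact: measurable_neqb. Qed.

Lemma bounded_measurable_differ c h : bounded_measurable (differ c h).
Proof. exact: (bounded_measurable_bool R (measurable_differ c h)). Qed.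

Lemma ErrE D h : Err D h = (err D h)%:E.
Proof. by rewrite /err (Rintegral_bool D (measurable_miss h)). Qed.

Lemma disagreementE DX c h : DX [set x | c x != h x] = (disagreement DX c h)%:E.
Proof. by rewrite /disagreement (Rintegral_bool DX (measurable_differ c h)). Qed.

Lemma err_ge0 D h : 0 <= err D h.
Proof. exact: Rintegral_ge0. Qed.

Lemma err_le1 D h : err D h <= 1.
Proof.
apply: Rintegral_le_cst => [|z]; first exact: bounded_measurable_miss.
by rewrite /miss lern1 leq_b1.
Qed.

Lemma disagreement_ge0 DX c h : 0 <= disagreement DX c h.
Proof. exact: Rintegral_ge0. Qed.

Lemma disagreementxx DX c : disagreement DX c c = 0.
Proof.
rewrite -[RHS](Rintegral_probability_cst DX); apply: eq_Rintegral => x _.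
by rewrite /differ eqxx.
Qed.

End errors.

#[local] Hint Extern 1 (bounded_measurable _) =>
  first [exact: bounded_measurable_miss | exact: bounded_measurable_differ]
  : bounded_measurable.

Section error_of_marginals_and_labellings.
Context (disp : measure_display) (X : measurableType disp) (R : realType).
Implicit Types (c h : hypothesis X).

HB.instance Definition _ :=
  isMeasurableFun.Build _ _ _ _ (@fst X bool) measurable_fst.

Lemma err_le_disagreement (D : probability (X * bool)%type R) c h :
  err D h <= err D c + disagreement (distribution D (@fst X bool)) c h.
Proof.
rewrite /disagreement Rintegral_distribution//.
have b_differ : bounded_measurable (fun z : X * bool => differ R c h z.1).
  exact: (bounded_measurable_comp measurable_fst).
rewrite -RintegralD//; apply: le_Rintegral => // z _.
by rewrite /miss /differ; case: (c z.1); case: (h z.1); case: z.2; rewrite /=; lra.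
Qed.

Definition labelled c (x : X) : X * bool := (x, c x).

Lemma measurable_labelled c : measurable_fun setT (labelled c).
Proof. exact: measurable_fun_pair. Qed.

HB.instance Definition _ c := isMeasurableFun.Build _ _ _ _ (labelled c) (measurable_labelled c).

Lemma err_labelled (DX : probability X R) c h :
  err (distribution DX (labelled c)) h = disagreement DX c h.
Proof.
rewrite /err Rintegral_distribution//; apply: eq_Rintegral => x _.
by rewrite /miss /differ eq_sym.
Qed.

End error_of_marginals_and_labellings.

(** * Private algorithms *)

Section algorithms.
Context (disp : measure_display) (Z : measurableType disp) (R : realType)
  (O : choiceType) (n m : nat).
Implicit Types (A : algorithm Z R O n m) (S : set O) (x : dataset Z n m).

Lemma alg_in_ge0 A x S : 0 <= alg_in A x S.
Proof. by apply: sumr_ge0 => o _; exact: alg_prob_ge0. Qed.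

Lemma alg_in_le1 A x S : alg_in A x S <= 1.
Proof.
rewrite -(alg_prob_sum1 A x) /alg_in [leRHS](bigID (fun o => o \in S))/= lerDl.
by apply: sumr_ge0 => o _; exact: alg_prob_ge0.
Qed.

Lemma alg_inE A x S :
  alg_in A x S = \sum_(o <- alg_outputs A) alg_prob A x o * (o \in S)%:R.
Proof.
by rewrite /alg_in big_mkcond; apply: eq_bigr => o _; case: ifP; rewrite ?mulr1 ?mulr0.
Qed.

Lemma le_alg_in A x S S' : S `<=` S' -> alg_in A x S <= alg_in A x S'.
Proof.
move=> SS'; rewrite !alg_inE; apply: ler_sum => o _; apply: ler_wpM2l; first exact: alg_prob_ge0.
by rewrite ler_nat; case: (boolP (o \in S)) => // /set_mem/SS'/mem_set ->.
Qed.

Lemma bounded_measurable_alg_in A S : bounded_measurable (fun x => alg_in A x S).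
Proof.
split; last by exists 1 => x; rewrite ger0_norm ?alg_in_ge0 ?alg_in_le1.
under eq_fun do rewrite alg_inE; apply: measurable_sum => o.
by apply: measurable_funM; [exact: alg_prob_measurable | exact: measurable_cst].
Qed.

Lemma solves_Rintegral_ge A (T : task Z R O) (D : probability Z R) :
  solves T A -> task_valid T D ->
  2 / 3 <= \int[iid (iid D m) n]_x alg_in A x (task_correct T D).
Proof.
move=> A_solves /A_solves; rewrite -EFin_Rintegral ?lee_fin//.
exact: bounded_measurable_alg_in.
Qed.

Lemma DP_ratio A eps x x' S : user_level_DP eps 0 A -> user_neighbors x x' ->
  alg_in A x S <= expR eps * alg_in A x' S.
Proof. by move=> A_DP xx'; rewrite -[leRHS]addr0; exact: A_DP. Qed.

Lemma group_privacy A eps x x' S : user_level_DP eps 0 A ->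
  alg_in A x S <= expR (eps * n%:R) * alg_in A x' S.
Proof.
move=> A_DP.
pose hybrid k : dataset Z n m := [tuple if (i < k)%N then tnth x' i else tnth x i | i < n].
have -> : x' = hybrid n by apply: eq_from_tnth => i; rewrite tnth_mktuple ltn_ord.
suff hybrid_le k : (k <= n)%N -> alg_in A x S <= expR (eps * k%:R) * alg_in A (hybrid k) S.
  exact: hybrid_le.
elim: k => [_|k IHk lt_kn].
  rewrite mulr0 expR0 mul1r (_ : hybrid 0%N = x)//.
  by apply: eq_from_tnth => i; rewrite tnth_mktuple.
rewrite (le_trans (IHk (ltnW lt_kn)))// -natr1 mulrDr mulr1 expRD -mulrA.
rewrite ler_wpM2l ?expR_ge0// DP_ratio//; exists (Ordinal lt_kn) => j jk.
by rewrite !tnth_mktuple ltnS [in RHS]leq_eqVlt (negbTE (jk : j != k :> nat)).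
Qed.

End algorithms.

Section kernel_algorithm.
Context (disp : measure_display) (Z : measurableType disp) (R : realType)
  (O : choiceType) (n m : nat) (J : finType).
Variables (w : dataset Z n m -> J -> R) (out : J -> O).
Hypotheses (pmf_w : forall x, finite_pmf (w x))
  (measurable_w : forall j, measurable_fun setT (w ^~ j)).

Let outputs : {fset O} := [fset o in codom out]%fset.

Let output_prob x o : R := \sum_(j | out j == o) w x j.

Let sum_output_prob x (E : pred O) :
  \sum_(o <- outputs | E o) output_prob x o = \sum_(j | E (out j)) w x j.
Proof.
rewrite (exchange_big_dep xpredT)//= [RHS]big_mkcond; apply: eq_bigr => j _.
have out_j : out j \in outputs by rewrite inE codom_f.
rewrite big_mkcond (bigD1_seq (out j) out_j (fset_uniq _))/= eqxx andbT.
by rewrite [X in _ + X]big1 ?addr0// => o /negbTE; rewrite eq_sym => ->; rewrite andbF.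
Qed.

Let output_prob_ge0 x o : 0 <= output_prob x o.
Proof. by apply: sumr_ge0 => j _; case: (pmf_w x). Qed.

Let output_prob_supp x o : o \notin outputs -> output_prob x o = 0.
Proof.
rewrite inE => o_out; rewrite /output_prob big_pred0// => j.
by apply: contraNF o_out => /eqP <-; exact: codom_f.
Qed.

Let output_prob_sum1 x : \sum_(o <- outputs) output_prob x o = 1.
Proof. by rewrite (sum_output_prob x xpredT); case: (pmf_w x). Qed.

Let measurable_output_prob o : measurable_fun setT (output_prob ^~ o).
Proof.
rewrite /output_prob; under eq_fun do rewrite big_mkcond.
by apply: measurable_sum => j; case: (out j == o) => //; exact: measurable_cst.
Qed.

Definition kernel_algorithm : algorithm Z R O n m :=
  Algorithm output_prob_ge0 output_prob_supp output_prob_sum1 measurable_output_prob.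

Lemma alg_in_kernel x S : alg_in kernel_algorithm x S = \sum_(j | out j \in S) w x j.
Proof. exact: (sum_output_prob x (fun o => o \in S)). Qed.

Lemma kernel_algorithm_DP eps :
  (forall x x' j, user_neighbors x x' -> w x j <= expR eps * w x' j) ->
  user_level_DP eps 0 kernel_algorithm.
Proof.
move=> w_ratio x x' S xx'; rewrite !alg_in_kernel addr0 mulr_sumr.
by apply: ler_sum => j _; exact: w_ratio.
Qed.

End kernel_algorithm.

(** * Lower bounds from a shattered set *)

Section packing.
Context (R : realType) (k : nat) (J : finType).
Local Notation cube := {ffun 'I_k -> bool}.
Variables (Q : J -> R) (F : cube -> J -> R).
Hypotheses (pmf_Q : finite_pmf Q) (sum_F_le : forall j, \sum_u F u j <= (6 / 5) ^+ k).

Lemma exists_light_vertex : exists u, \sum_j Q j * F u j <= (3 / 5) ^+ k.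
Proof.
pose mean u := \sum_j Q j * F u j.
have [u _ u_min] := arg_minP mean (i0 := [ffun=> false] : cube) (P := xpredT) isT.
exists u; rewrite -(ler_pM2l (exprn_gt0 k (ltr0n R 2))) -exprMn.
rewrite (_ : 2 * (3 / 5) = 6 / 5); last by field.
apply: (@le_trans _ _ (\sum_v mean v)).
  apply: (@le_trans _ _ (\sum_(v : cube) mean u)); last by apply: ler_sum => v _; exact: u_min.
  by rewrite sumr_const_mull card_ffun card_bool card_ord natrX.
rewrite exchange_big/=; under eq_bigr do rewrite -mulr_sumr.
exact: finite_pmf_mean_le.
Qed.

Variable P : cube -> J -> R.
Hypotheses (k_gt0 : (0 < k)%N) (P_mean_ge : forall u, 2 / 3 <= \sum_j P u j * F u j).

Lemma packing_ratio_ge (rho : R) : 0 <= rho ->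
  (forall u, \sum_j P u j * F u j <= rho * \sum_j Q j * F u j) ->
  expR (k%:R / 10) <= rho.
Proof.
move=> rho_ge0 ratio_le; have [u light_u] := exists_light_vertex.
have rho_mass : 2 / 3 <= rho * (3 / 5) ^+ k.
  rewrite (le_trans (P_mean_ge u))// (le_trans (ratio_le u))//.
  exact: ler_wpM2l.
rewrite [k%:R / 10]mulrC; apply: (@le_trans _ _ ((10 / 9) ^+ k)).
  by apply: expRM_natr_le_exprn; lra.
have mass_gt0 : 0 < (3 / 5 : R) ^+ k by rewrite exprn_gt0//; lra.
rewrite -(ler_pM2r mass_gt0) (le_trans _ rho_mass)// -exprMn.
rewrite (_ : 10 / 9 * (3 / 5) = 2 / 3); last by field.
by rewrite -[leRHS]expr1; apply: ler_wiXn2l => //; lra.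
Qed.

Lemma exprn_le_1Dexprn : (251 / 250 : R) ^+ k <= 1 + (5 / 3) ^+ k / 225.
Proof.
case: k k_gt0 => // k' _; elim: k' => [|k' IHk]; first by rewrite !expr1; lra.
have five_thirds_le : 5 / 3 <= (5 / 3) ^+ k'.+1 :> R.
  by rewrite -[leLHS]expr1; apply: ler_weXn2l => //; lra.
rewrite (exprS _ k'.+1) (exprS (5 / 3) k'.+1); move: IHk five_thirds_le.
by set a := (251 / 250) ^+ _; set b := (5 / 3) ^+ _; lra.
Qed.

Lemma packing_chi2_ge (chi : R) :
  (forall j, 0 < Q j) -> (forall u, \sum_j P u j = 1) ->
  (forall u, chi2 (P u) Q <= chi) -> (forall u j, 0 <= F u j <= 1) ->
  expR (k%:R / 251) <= 1 + chi.
Proof.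
move=> Q_gt0 P_mass chi2_le F01; have [u light_u] := exists_light_vertex.
set mean := \sum_j _ in light_u.
have F_mean_ge0 : 0 <= \sum_j Q j * F u j ^+ 2.
  by apply: sumr_ge0 => j _; rewrite mulr_ge0 ?sqr_ge0 ?ltW.
have chi2_ge0 : 0 <= chi2 (P u) Q.
  by apply: sumr_ge0 => j _; rewrite divr_ge0 ?sqr_ge0 ?ltW.
have gap_sqr : (\sum_j P u j * F u j - mean) ^+ 2 <= chi * (3 / 5) ^+ k.
  rewrite /mean -sumrB; under eq_bigr do rewrite -mulrBl.
  rewrite (le_trans (chi2_mean_sub_sqr _ _ Q_gt0))// ler_pM//.
  apply: le_trans light_u; apply: ler_sum => j _; apply: ler_wpM2l; first exact: ltW.
  by have /andP[F_ge0 F_le1] := F01 u j; rewrite expr2 ler_piMr.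
have gap_ge : 1 / 225 <= chi * (3 / 5) ^+ k.
  have : (3 / 5 : R) ^+ k <= 3 / 5 by rewrite -[leRHS]expr1; apply: ler_wiXn2l => //; lra.
  by have := P_mean_ge u; nra.
have chi_ge : (5 / 3) ^+ k / 225 <= chi.
  have pow_gt0 : 0 < (3 / 5 : R) ^+ k by rewrite exprn_gt0//; lra.
  rewrite -(ler_pM2r pow_gt0) mulrAC -exprMn (_ : 5 / 3 * (3 / 5) = 1) ?expr1n//.
  by field.
rewrite [k%:R / 251]mulrC (le_trans (expRM_natr_le_exprn _ (y := 251 / 250) _ _))//; [lra | lra |].
by rewrite (le_trans exprn_le_1Dexprn)// lerD2l.
Qed.

End packing.

Section biased_labels.
Context (R : realType) (k : nat).
Hypothesis k_gt0 : (0 < k)%N.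
Local Notation labelled_node := ('I_k * bool)%type.
Implicit Types (u v : 'I_k -> bool) (beta : R).

(* A uniform node, whose label agrees with [u] with probability [(1 + beta) / 2]. *)
Definition biased_pmf beta u (z : labelled_node) : R :=
  (2 * k%:R)^-1 * (1 + (if z.2 == u z.1 then beta else - beta)).

Let kR_gt0 : 0 < k%:R :> R.
Proof. by rewrite ltr0n. Qed.

Lemma biased_pmf_gt0 beta u z : 0 <= beta < 1 -> 0 < biased_pmf beta u z.
Proof.
move=> /andP[beta_ge0 beta_lt1].
by rewrite /biased_pmf mulr_gt0 ?invr_gt0 ?mulr_gt0//; case: ifP => _; lra.
Qed.

Lemma sum_labelled_node (F : labelled_node -> R) u :
  \sum_z F z = \sum_i (F (i, u i) + F (i, ~~ u i)).
Proof.
rewrite (eq_bigr (fun z => F (z.1, z.2))); last by case.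
rewrite -(pair_bigA _ (fun i b => F (i, b)))/=; apply: eq_bigr => i _.
by rewrite big_bool/=; case: (u i); rewrite // addrC.
Qed.

Lemma sum_biased_pmf beta u : \sum_z biased_pmf beta u z = 1.
Proof.
rewrite (sum_labelled_node _ u) (eq_bigr (fun=> k%:R^-1)).
  by rewrite sumr_const_mull card_ord mulfV// gt_eqF.
by move=> i _; rewrite /biased_pmf/= eqxx; case: (u i) => /=; field; rewrite gt_eqF.
Qed.

Lemma chi2_biased_pmf beta u v : chi2 (biased_pmf beta u) (biased_pmf 0 v) = beta ^+ 2.
Proof.
rewrite /chi2 (eq_bigr (fun=> (2 * k%:R)^-1 * beta ^+ 2)); last first.
  by move=> z _; rewrite /biased_pmf oppr0 if_same; case: ifP => _; field; rewrite gt_eqF.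
by rewrite sumr_const_mull card_prod card_bool card_ord natrM; field; rewrite gt_eqF.
Qed.

Lemma biased_pmf_mean_neq beta u v :
  \sum_z biased_pmf beta u z * (v z.1 != z.2)%:R =
  (1 - beta) / 2 + beta / k%:R * (hamming u v)%:R.
Proof.
rewrite (sum_labelled_node _ u)
  (eq_bigr (fun i => (2 * k%:R)^-1 * (1 - beta) + beta / k%:R * (u i != v i)%:R)); last first.
  move=> i _; rewrite /biased_pmf/= eqxx.
  by case: (u i); case: (v i); rewrite /= ?mulr0 ?mulr1; field; rewrite gt_eqF.
rewrite big_split/= sumr_const_mull card_ord -mulr_sumr; congr (_ + _ * _).
  by field; rewrite gt_eqF.
rewrite /hamming -sum1_card natr_sum [RHS]big_mkcond/=; apply: eq_bigr => i _.
by rewrite inE; case: (_ != _).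
Qed.

End biased_labels.

Section shattered_set.
Context (R : realType) (disp : measure_display) (X : measurableType disp).
Context (C : set (hypothesis X)) (S : {fset X}) (k : nat).
Hypotheses (C_shatters_S : shatters C S) (card_S : #|` S| = k).

Definition node (i : 'I_k) : X := nth point (enum_fset S) i.

Definition trace (h : hypothesis X) (i : 'I_k) : bool := h (node i).

Lemma node_in i : node i \in S.
Proof. by apply: mem_nth; rewrite card_S. Qed.

Lemma node_inj : injective node.
Proof.
have size_S : size (enum_fset S) = k by rewrite -card_S.
move=> i j /eqP; rewrite nth_uniq ?fset_uniq ?size_S//.
by move/eqP/val_inj.
Qed.

Lemma trace_surj (u : 'I_k -> bool) : exists2 c, C c & trace c =1 u.
Proof.
have [c Cc cE] := C_shatters_S [set x | exists2 i, x = node i & u i].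
exists c => // i; apply/idP/idP => [/(cE _ (node_in i)).1[j /node_inj <-]//|ui].
by apply: (cE _ (node_in i)).2; exists i.
Qed.

Definition labelled_example (z : 'I_k * bool) : X * bool := (node z.1, z.2).

Hypothesis k_gt0 : (0 < k)%N.
Variables (alpha : R) (u : 'I_k -> bool) (D : probability (X * bool)%type R).
Hypotheses (alpha_gt0 : 0 < alpha)
  (D_law : discrete_law D (biased_pmf (32 * alpha) u) labelled_example).

Lemma err_biased h :
  err D h = (1 - 32 * alpha) / 2 + 32 * alpha / k%:R * (hamming u (trace h))%:R.
Proof.
by rewrite /err D_law; [exact: (biased_pmf_mean_neq k_gt0 (32 * alpha) u (trace h))|].
Qed.

Lemma correct_near_labels :
  task_correct (agn C alpha) D `<=` [set h | (32 * hamming u (trace h) <= k)%N].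
Proof.
move=> h /= h_correct; have [c Cc cE] := trace_surj u.
have : err D h <= err D c + alpha.
  rewrite -lee_fin EFinD -!ErrE (le_trans h_correct)// leeD2r//.
  by apply: ereal_inf_lbound; exists c.
have -> : err D c = (1 - 32 * alpha) / 2.
  by rewrite err_biased eq_hamming0 ?mulr0 ?addr0.
have k_gt0R : 0 < k%:R :> R by rewrite ltr0n.
rewrite err_biased lerD2l mulrAC ler_pdivrMr// [leRHS]mulrC [leLHS]mulrAC ler_pM2r//.
by rewrite -natrM ler_nat.
Qed.

End shattered_set.

Section vc_lower_bound.
Context (R : realType) (disp : measure_display) (X : measurableType disp).
Context (C : set (hypothesis X)) (S : {fset X}) (k : nat).
Context (alpha eps : R) (n m : nat) (A : algorithm (X * bool)%type R (hypothesis X) n m).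
Hypotheses (C_shatters_S : shatters C S) (card_S : #|` S| = k) (k_gt0 : (0 < k)%N)
  (alpha_gt0 : 0 < alpha) (alpha_le : alpha <= 1 / 64)
  (A_solves : solves (agn C alpha) A).
Local Notation cube := {ffun 'I_k -> bool}.
Local Notation samples := (n.-tuple (m.-tuple ('I_k * bool))).
Local Notation beta := (32 * alpha).
Implicit Types (u : cube) (t : samples).

Let user_pmf (b : R) u := tuple_pmf m (biased_pmf b u).

Let no_bias : cube := [ffun=> false].

Definition near_labels u : set (hypothesis X) :=
  [set h | (32 * hamming u (trace S h) <= k)%N].

Definition hit_prob u t : R :=
  alg_in A (map_tuple (fun s => map_tuple (@labelled_example _ _ S k) s) t) (near_labels u).

Lemma biased_pmf_beta_gt0 u z : 0 < biased_pmf beta u z.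
Proof. by apply: biased_pmf_gt0 => //; have := alpha_gt0; have := alpha_le; lra. Qed.

Lemma unbiased_pmf_gt0 u z : 0 < biased_pmf (0 : R) u z.
Proof. by apply: biased_pmf_gt0 => //; rewrite lexx ltr01. Qed.

Lemma finite_pmf_biased u : finite_pmf (biased_pmf beta u).
Proof. by split; [move=> z; exact/ltW/biased_pmf_beta_gt0 | exact: sum_biased_pmf]. Qed.

Lemma finite_pmf_unbiased u : finite_pmf (biased_pmf (0 : R) u).
Proof. by split; [move=> z; exact/ltW/unbiased_pmf_gt0 | exact: sum_biased_pmf]. Qed.

Lemma finite_pmf_unbiased_samples : finite_pmf (tuple_pmf n (user_pmf 0 no_bias)).
Proof. exact/finite_pmf_tuple/finite_pmf_tuple/finite_pmf_unbiased. Qed.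

Lemma hit_prob_mean_ge u : 2 / 3 <= \sum_t tuple_pmf n (user_pmf beta u) t * hit_prob u t.
Proof.
have [D D_law] := discrete_law_exists (@labelled_example _ _ S k) (finite_pmf_biased u).
have users_law := discrete_law_iid (n := n) (discrete_law_iid (n := m) D_law).
rewrite -(users_law _ (bounded_measurable_alg_in A (near_labels u))).
apply: le_trans (solves_Rintegral_ge A_solves (D := D) Logic.I) _.
apply: le_Rintegral => //; [exact/bounded_measurable_integrable/bounded_measurable_alg_in..|].
by move=> x _; apply: le_alg_in; exact: correct_near_labels D_law.
Qed.

Lemma sum_hit_prob_le t : \sum_u hit_prob u t <= (6 / 5) ^+ k.
Proof.
rewrite /hit_prob; move: (map_tuple _ t) => x; under eq_bigr do rewrite alg_inE.
rewrite exchange_big/=.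
apply: (@le_trans _ _ (\sum_(h <- alg_outputs A) alg_prob A x h * (6 / 5) ^+ k)); last first.
  by rewrite -mulr_suml alg_prob_sum1 mul1r.
apply: ler_sum => h _; rewrite -mulr_sumr ler_wpM2l ?alg_prob_ge0//.
by apply: le_trans (hamming_ball32_le R (trace S h)); under eq_bigr do rewrite mem_setE.
Qed.

Lemma sample_size_lower_bound : k%:R <= 1024 * 251 * (alpha ^+ 2 * m%:R) * n%:R.
Proof.
have : expR (k%:R / 251) <= expR (beta ^+ 2 * m%:R * n%:R).
  rewrite -[leRHS](subrK 1) [leRHS]addrC.
  apply: (packing_chi2_ge finite_pmf_unbiased_samples sum_hit_prob_le k_gt0 hit_prob_mean_ge).
  - by move=> t; apply: tuple_pmf_gt0 => s; apply: tuple_pmf_gt0 => z; exact: unbiased_pmf_gt0.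
  - by move=> u; rewrite !sum_tuple_pmf sum_biased_pmf// !expr1n.
  - move=> u; rewrite !chi2_tuple ?sum_tuple_pmf ?sum_biased_pmf ?expr1n//; last 2 first.
    + by move=> z; exact: unbiased_pmf_gt0.
    + by move=> s; apply: tuple_pmf_gt0 => z; exact: unbiased_pmf_gt0.
    rewrite [1 + (_ - 1)]addrC subrK chi2_biased_pmf// lerD2r expRM_natr.
    rewrite lerXn2r ?nnegrE ?expR_ge0 ?exprn_ge0 ?addr_ge0 ?sqr_ge0//.
    by apply: exprn1D_le_expR; have := sqr_ge0 beta; lra.
  - by move=> u t; rewrite alg_in_ge0 alg_in_le1.
by rewrite ler_expR exprMn; lra.
Qed.

Hypotheses (eps_gt0 : 0 < eps) (A_DP : user_level_DP eps 0 A).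

Lemma hit_prob_adjacent u t t' : adjacent t t' -> hit_prob u t <= expR eps * hit_prob u t'.
Proof.
move=> [i tt']; apply: DP_ratio => //; exists i => j ji.
by rewrite !tnth_map tt'.
Qed.

Lemma privacy_packing (rho : R) : 0 <= rho ->
  (forall u f, (forall s, 0 <= f s) -> (forall s s', f s <= expR eps * f s') ->
     \sum_s user_pmf beta u s * f s <= rho * \sum_s user_pmf 0 no_bias s * f s) ->
  expR (k%:R / 10) <= rho ^+ n.
Proof.
move=> rho_ge0 one_user.
apply: (packing_ratio_ge finite_pmf_unbiased_samples sum_hit_prob_le k_gt0 hit_prob_mean_ge).
  exact: exprn_ge0.
move=> u; apply: (tuple_mean_le_ratio (c := expR eps)) => //.
- by move=> s; apply: tuple_pmf_ge0 => z; exact/ltW/unbiased_pmf_gt0.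
- by move=> s; apply: tuple_pmf_ge0 => z; exact/ltW/biased_pmf_beta_gt0.
- exact: one_user.
- by move=> t; exact: alg_in_ge0.
- exact: hit_prob_adjacent.
Qed.

Lemma user_count_lower_bound : k%:R / 10 <= eps * n%:R.
Proof.
rewrite -ler_expR expRM_natr; apply: privacy_packing; first exact: expR_ge0.
move=> u f _ f_ratio; apply: mean_le_ratio_mean => //.
  exact/finite_pmf_tuple/finite_pmf_biased.
exact/finite_pmf_tuple/finite_pmf_unbiased.
Qed.

Lemma chi2_user_pmf_le u : beta ^+ 2 * m%:R <= 1 / 2 ->
  chi2 (user_pmf beta u) (user_pmf 0 no_bias) <= (2 * beta * Num.sqrt m%:R) ^+ 2.
Proof.
move=> few_samples; rewrite chi2_tuple ?sum_biased_pmf//; last exact: unbiased_pmf_gt0.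
have samples_ge0 : 0 <= beta ^+ 2 * m%:R by rewrite mulr_ge0 ?sqr_ge0.
have pow_le : (1 + beta ^+ 2) ^+ m <= expR (beta ^+ 2 * m%:R).
  by apply: exprn1D_le_expR; have := sqr_ge0 beta; lra.
have exp_le : expR (beta ^+ 2 * m%:R) <= 1 + 2 * (beta ^+ 2 * m%:R).
  by apply: expR_le1D2x; rewrite samples_ge0.
rewrite chi2_biased_pmf// [leRHS]exprMn sqr_sqrtr//; lra.
Qed.

Lemma few_samples_lower_bound : eps <= 1 / 2 -> beta ^+ 2 * m%:R <= 1 / 2 ->
  k%:R / 10 <= 128 * (alpha * eps * Num.sqrt m%:R) * n%:R.
Proof.
move=> eps_le few_samples.
have exp_ge1 : 1 <= expR eps by rewrite ltW// expR_gt1.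
have exp_le : expR eps - 1 <= 2 * eps.
  by have := @expR_le1D2x R eps; rewrite (ltW eps_gt0) eps_le; lra.
have chi_ge0 : 0 <= 2 * beta * Num.sqrt m%:R.
  by rewrite mulr_ge0 ?sqrtr_ge0//; have := alpha_gt0; lra.
have excess_ge0 : 0 <= 2 * beta * Num.sqrt m%:R * (expR eps - 1) by rewrite mulr_ge0 ?subr_ge0.
have growth : expR (k%:R / 10) <= (1 + 2 * beta * Num.sqrt m%:R * (expR eps - 1)) ^+ n.
  apply: privacy_packing; first by rewrite addr_ge0.
  move=> u f f_ge0 f_ratio; apply: mean_le_chi2_mean => //.
  - by move=> s; apply: tuple_pmf_gt0; exact: unbiased_pmf_gt0.
  - exact/finite_pmf_tuple/finite_pmf_unbiased.
  - by rewrite sum_tuple_pmf sum_biased_pmf// expr1n.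
  - exact: chi2_user_pmf_le.
apply: (@le_trans _ _ (2 * beta * Num.sqrt m%:R * (expR eps - 1) * n%:R)).
  by rewrite -ler_expR (le_trans growth)// exprn1D_le_expR//; lra.
apply: (@le_trans _ _ (2 * beta * Num.sqrt m%:R * (2 * eps) * n%:R)); last by lra.
by rewrite ler_wpM2r// ler_wpM2l.
Qed.

(* With many samples per user, [alpha * sqrt m] is bounded below and the bound for
   [user_count_lower_bound] already suffices. *)
Lemma private_sample_lower_bound : eps <= 1 / 2 ->
  k%:R <= 1280 * (alpha * eps * Num.sqrt m%:R) * n%:R.
Proof.
move=> eps_le; have [few_samples|many_samples] := leP (beta ^+ 2 * m%:R) (1 / 2).
  by have := few_samples_lower_bound eps_le few_samples; lra.
have root_ge : 1 <= 2 * beta * Num.sqrt m%:R.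
  have : 1 ^+ 2 <= (2 * beta * Num.sqrt m%:R) ^+ 2.
    by rewrite !exprMn sqr_sqrtr//; move: many_samples; rewrite exprMn; lra.
  by rewrite ler_pXn2r// ?nnegrE// !mulr_ge0 ?sqrtr_ge0 ?ltW.
have users_ge0 : 0 <= eps * n%:R by rewrite mulr_ge0 ?(ltW eps_gt0).
by have := user_count_lower_bound; have := ler_wpM2r users_ge0 root_ge; lra.
Qed.

End vc_lower_bound.

(** * Probabilistic representations and priors *)

Section finite_esum.
Context (R : realType) (K : choiceType) (P : K -> R).
Implicit Types (A : {fset K}) (S : set K).

Lemma fset_sum_le_esum A S :
  ((\sum_(k <- A | k \in S) P k)%:E <= \esum_(k in S) (P k)%:E)%E.
Proof.
rewrite esum_mkcond; apply: esum_ge; exists [set` A] => //.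
rewrite fsbig_finite// set_fsetK big_mkcond -sumEFin lee_sum// => k _.
by case: ifP => _; rewrite lexx.
Qed.

Lemma fset_sum_setC_le A S (b : R) : (forall k, 0 <= P k) -> (\esum_(k in setT) (P k)%:E = 1)%E ->
  ((1 - b)%:E <= \esum_(k in S) (P k)%:E)%E -> \sum_(k <- A | k \notin S) P k <= b.
Proof.
move=> P_ge0; rewrite (esumID S) ?setTI; last by move=> k _; rewrite lee_fin.
move=> massE S_ge; have := leeD S_ge (fset_sum_le_esum A (~` S)).
rewrite massE -EFinD lee_fin; under eq_bigl do rewrite in_setC.
by lra.
Qed.

Lemma lt_esum_fset (t : R) : (t%:E < \esum_(k in setT) (P k)%:E)%E ->
  exists A, t < \sum_(k <- A) P k.
Proof.
move=> /ereal_sup_gt[_ [B [finB _] <-]].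
by rewrite fsbig_finite// sumEFin lte_fin; exists (fset_set B).
Qed.

Lemma esum_fiber_sum (J : finType) (f : J -> K) (w : J -> R) S : (forall j, 0 <= w j) ->
  (\esum_(k in S) (\sum_(j | f j == k) w j)%:E = (\sum_(j | f j \in S) w j)%:E)%E.
Proof.
move=> w_ge0; under eq_esum => k _ do rewrite big_mkcond -sumEFin.
rewrite esum_sum; last by move=> k j _ _; case: ifP; rewrite lee_fin.
rewrite [in RHS]big_mkcond/= -sumEFin; apply: eq_bigr => j _.
rewrite esum_mkcond (esumID [set f j]); last first.
  by move=> k _; case: ifP => // _; case: ifP; rewrite lee_fin.
rewrite setTI [X in (_ + X)%E]esum1 ?adde0; last first.
  by move=> k [_ /= /eqP]; rewrite eq_sym => /negbTE ->; case: ifP.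
rewrite esum_set1 ?eqxx; first by case: ifP.
by case: ifP => // _; rewrite lee_fin.
Qed.

End finite_esum.

Section representation_dimension.
Context (R : realType) (disp : measure_display) (X : measurableType disp).
Implicit Types (C : set (hypothesis X)) (c h : hypothesis X) (D : probability X R)
  (H : {fset hypothesis X}) (P : {fset hypothesis X} -> R).

Definition covers D c (a : R) H := has (fun h => disagreement D c h <= a) H.

Lemma coversE D c a :
  [set H : {fset hypothesis X} | exists2 h, h \in H & (D [set x | c x != h x] <= a%:E)%E] =
  [set H | covers D c a H].
Proof.
apply/seteqP; split=> H /=; last first.
  by move=> /hasP[h hH h_close]; exists h => //; rewrite disagreementE lee_fin.
by move=> [h hH]; rewrite disagreementE lee_fin => h_close; apply/hasP; exists h.
Qed.

Lemma cover_mass_ge C c D (a b : R) P (A : {fset {fset hypothesis X}}) :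
  prob_representation C a b P -> C c ->
  \sum_(H <- A) P H - b <= \sum_(H <- A | covers D c a H) P H.
Proof.
move=> [[P_ge0 P_mass] rep_P] Cc; have := rep_P c Cc D; rewrite coversE => cover_mass.
have bad_mass : \sum_(H <- A | ~~ covers D c a H) P H <= b.
  have := fset_sum_setC_le A P_ge0 P_mass cover_mass.
  by under eq_bigl do rewrite mem_setE.
by rewrite (bigID (covers D c a))/=; lra.
Qed.

Lemma is_pmf_exists_gt0 P : is_pmf P -> exists H, 0 < P H.
Proof.
move=> [P_ge0 P_mass]; apply: contrapT => no_support; move: P_mass.
rewrite esum1; first by move/esym/eqP; rewrite onee_eq0.
move=> H _; congr (_%:E); apply/eqP; rewrite eq_le P_ge0 andbT leNgt.
by apply/negP => PH_gt0; apply: no_support; exists H.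
Qed.

Lemma PRDim_ge0 C (d : R) : PRDim R C = d%:E -> 0 <= d.
Proof.
move=> Cd; rewrite -lee_fin -Cd; apply: le_ereal_inf_tmp => _ [P [pmf_P _] <-].
have [H PH_gt0] := is_pmf_exists_gt0 pmf_P.
apply: (@le_trans _ _ (ln (#|` H|%:R : R))%:E).
  by rewrite lee_fin -(ln0 (lexx (0 : R))); exact: (@ler_ln_nat _ 0).
by apply: ereal_sup_ubound; exists H.
Qed.

Lemma PRDim_near_optimal C (d e : R) : PRDim R C = d%:E -> 0 < e ->
  exists2 P : {fset hypothesis X} -> R, prob_representation C (1 / 4) (1 / 4) P &
    forall H, 0 < P H -> #|` H|%:R <= expR (d + e).
Proof.
move=> Cd e_gt0.
have PRDim_fin : PRDim R C \is a fin_num by rewrite Cd.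
have [_ [P rep_P <-]] := lb_ereal_inf_adherent e_gt0 PRDim_fin.
rewrite -/(PRDim R C) Cd -EFinD => size_P; exists P => // H PH_gt0.
have [->|card_H] := posnP #|` H|; first exact: expR_ge0.
rewrite -[leLHS]lnK ?posrE ?ltr0n// ler_expR -lee_fin.
by apply/ltW/(le_lt_trans _ size_P)/ereal_sup_ubound; exists H.
Qed.

(* Up to constants, a class has a prior with [a = 1/4] and [gamma = exp (- d)] iff its
   representation dimension is [d]: see [PRDim_prior] and [PRDim_le_ln_prior]. *)
Definition prior C (a gamma : R) (I : finType) (p : I -> R) (h : I -> hypothesis X) :=
  finite_pmf p /\
  forall c D, C c -> gamma <= \sum_(i | disagreement D c (h i) <= a) p i.

Lemma weighted_seq_prior C (a gamma : R) (s : seq (R * hypothesis X)) :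
  (forall wh, wh \in s -> 0 <= wh.1) -> \sum_(wh <- s) wh.1 <= 1 ->
  (forall c D, C c -> gamma <= \sum_(wh <- s | disagreement D c wh.2 <= a) wh.1) ->
  exists (I : finType) (p : I -> R) (h : I -> hypothesis X), prior C a gamma p h.
Proof.
move=> s_ge0 s_mass s_covers.
pose s1 := (1 - \sum_(wh <- s) wh.1, cst false : hypothesis X) :: s.
exists 'I_(size s1), (fun i => (tnth (in_tuple s1) i).1), (fun i => (tnth (in_tuple s1) i).2).
have s1_ge0 wh : wh \in s1 -> 0 <= wh.1.
  by rewrite inE => /predU1P[->|/s_ge0//]; rewrite subr_ge0.
split; first split.
- by move=> i; apply: s1_ge0; exact: mem_tnth.
- by rewrite -(big_tnth _ _ s1 xpredT (fun wh => wh.1)) big_cons subrK.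
move=> c D Cc; rewrite (le_trans (s_covers c D Cc))//.
rewrite -(big_tnth _ _ s1 (fun wh => disagreement D c wh.2 <= a) (fun wh => wh.1)) big_cons.
by case: ifP => // _; rewrite lerDr subr_ge0.
Qed.

Lemma uniform_member_mass D c (a N : R) P H : 0 <= P H -> (0 < P H -> #|` H|%:R <= N) ->
  covers D c a H -> P H / N <= \sum_(h <- H | disagreement D c h <= a) P H / #|` H|%:R.
Proof.
move=> PH_ge0 card_le /hasP[h hH h_close].
have terms_ge0 : 0 <= P H / #|` H|%:R by rewrite divr_ge0.
rewrite big_mkcond (bigD1_seq h hH (fset_uniq _))/= h_close -[leLHS]addr0 lerD//; last first.
  by apply: sumr_ge0 => h' _; case: ifP.
have [->|PH_neq0] := eqVneq (P H) 0; first by rewrite !mul0r.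
have PH_gt0 : 0 < P H by rewrite lt_neqAle eq_sym PH_neq0.
have card_gt0 : 0 < #|` H|%:R :> R by rewrite ltr0n cardfs_gt0; apply/fset0Pn; exists h.
by rewrite ler_pM2l// lef_pV2 ?posrE ?card_le// (lt_le_trans card_gt0)// card_le.
Qed.

Lemma PRDim_prior C (d : R) : PRDim R C = d%:E ->
  exists (I : finType) (p : I -> R) (h : I -> hypothesis X),
    prior C (1 / 4) (6 / 10 * expR (- d)) p h.
Proof.
move=> Cd; have e_gt0 : 0 < 1 / 20 :> R by lra.
have [P rep_P card_le] := PRDim_near_optimal Cd e_gt0; have [[P_ge0 P_mass] _] := rep_P.
have [|A A_mass] := @lt_esum_fset _ _ P (9 / 10); first by rewrite P_mass lte_fin; lra.
pose s := [seq (P H / #|` H|%:R, h) | H <- A, h <- enum_fset H].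
apply: (@weighted_seq_prior C _ _ s).
- by move=> _ /allpairsPdep[H [h [_ _ ->]]]; rewrite divr_ge0.
- rewrite big_allpairs_dep/=; apply: (@le_trans _ _ (\sum_(H <- A) P H)); last first.
    have := @fset_sum_le_esum _ _ P A setT; rewrite P_mass lee_fin.
    by under eq_bigl do rewrite in_setT.
  apply: ler_sum => H _; rewrite big_const_seq count_predT iter_addr addr0 -[leLHS]mulr_natr.
  by have [->|] := eqVneq #|` H|%:R (0 : R); rewrite ?mulr0// => card_neq0; rewrite divfK.
move=> c D Cc.
have good_mass : 65 / 100 <= \sum_(H <- A | covers D c (1 / 4) H) P H.
  by have := cover_mass_ge D A rep_P Cc; lra.
rewrite big_mkcond big_allpairs_dep/=.
apply: (@le_trans _ _ (\sum_(H <- A | covers D c (1 / 4) H) P H / expR (d + 1 / 20))).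
  rewrite -mulr_suml -expRN opprD expRD mulrCA [leLHS]mulrC ler_pM2l ?expR_gt0//.
  by have := expR_ge1Dx (- (1 / 20) : R); nra.
rewrite big_mkcond; apply: ler_sum => H _; rewrite -big_mkcond/=; case: ifPn => [H_covers|_].
  exact: uniform_member_mass (card_le H) H_covers.
by apply: sumr_ge0 => h _; rewrite divr_ge0.
Qed.

Lemma PRDim_le_ln_tuple C (gamma : R) (I : finType) (p : I -> R) (h : I -> hypothesis X) M :
  prior C (1 / 4) gamma p h -> gamma <= 1 -> (1 - gamma) ^+ M <= 1 / 4 -> (0 < M)%N ->
  (PRDim R C <= (ln (M%:R : R))%:E)%E.
Proof.
move=> [pmf_p p_covers] gamma_le1 miss_le M_gt0.
pose range_of (t : M.-tuple I) : {fset hypothesis X} := [fset x in map h t]%fset.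
pose P H := \sum_(t | range_of t == H) tuple_pmf M p t.
have [tp_ge0 tp_mass] := finite_pmf_tuple M pmf_p.
apply: (@le_trans _ _ (prob_size P)).
  apply: ereal_inf_lbound; exists P => //; split; first split.
  - by move=> H; apply: sumr_ge0.
  - by rewrite (esum_fiber_sum _ _ tp_ge0) -tp_mass; under eq_bigl do rewrite in_setT.
  move=> c Cc D; rewrite coversE (esum_fiber_sum _ _ tp_ge0) lee_fin.
  pose close i := disagreement D c (h i) <= 1 / 4.
  rewrite (eq_bigl (fun t : M.-tuple I => has close t)) => [|t]; last first.
    rewrite mem_setE; apply/hasP/hasP => [[x]|[i it i_close]].
      by rewrite inE => /mapP[i it ->] i_close; exists i.
    by exists (h i) => //; rewrite inE map_f.
  rewrite tuple_pmf_has// lerD2l lerN2 (le_trans _ miss_le)// lerXn2r ?nnegrE ?subr_ge0//.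
    exact: finite_pmf_event_le1.
  by rewrite lerD2l lerN2; exact: p_covers.
apply: ge_ereal_sup => _ [H /= PH_gt0 <-]; rewrite lee_fin; apply: ler_ln_nat.
have [t /eqP <-] : exists t, range_of t == H.
  apply: contrapT => unreached; move: PH_gt0; rewrite /P big1 ?ltxx// => t tH.
  by case: unreached; exists t.
by rewrite card_fseq (leq_trans (size_undup _))// size_map size_tuple.
Qed.

Lemma PRDim_le_ln_prior C (gamma : R) (I : finType) (p : I -> R) (h : I -> hypothesis X) :
  prior C (1 / 4) gamma p h -> 0 < gamma <= 1 -> (PRDim R C <= (ln (3 / gamma))%:E)%E.
Proof.
move=> prior_p /andP[gamma_gt0 gamma_le1].
have [|M M_gt0 /andP[M_ge M_le]] := @exists_natr_itvcc R (2 / gamma).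
  by rewrite divr_ge0// ltW.
apply: (le_trans (PRDim_le_ln_tuple prior_p gamma_le1 _ M_gt0)).
  rewrite (le_trans (exprnB_le_expRN_div (c := 2) _ M_ge)) ?gamma_gt0//.
  by have := expRN2_le R; lra.
have gammaV_ge1 : 1 <= 1 / gamma by rewrite ler_pdivlMr// mul1r.
by rewrite lee_fin ler_ln_gt0 ?ltr0n//; lra.
Qed.

End representation_dimension.

Section nontrivial_classes.
Context (R : realType) (disp : measure_display) (X : measurableType disp).
Implicit Types (C : set (hypothesis X)) (c : hypothesis X).

Definition nontrivial C := exists c c' x, [/\ C c, C c' & c x != c' x].

Lemma trivial_eq C c c' : ~ nontrivial C -> C c -> C c' -> c' = c.
Proof.
move=> C_trivial Cc Cc'; apply/mfuneqP => x; apply/eqP; apply: contrapT => /negP cc'.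
by apply: C_trivial; exists c', c, x.
Qed.

Lemma VCdim_attained C (k : nat) : VCdim R C = k%:R%:E ->
  exists2 S, shatters C S & #|` S| = k.
Proof.
move=> Ck; have [_ [S C_shatters_S <-]] : exists2 y, [set (#|` S|%:R : R)%:E | S in shatters C] y &
    ((k%:R - 1 / 2)%:E < y)%E.
  by apply: ereal_sup_gt; rewrite -/(VCdim R C) Ck lte_fin; lra.
rewrite lte_fin => k_lt; exists S => //.
have S_le : ((#|` S|%:R : R)%:E <= k%:R%:E)%E by rewrite -Ck; apply: ereal_sup_ubound; exists S.
rewrite lee_fin ler_nat in S_le.
by apply/eqP; rewrite eqn_leq S_le /= -ltnS -(ltr_nat R) -natr1; lra.
Qed.

Lemma VCdim_class_neq0 C (k : nat) : VCdim R C = k%:R%:E -> C !=set0.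
Proof.
by move=> /VCdim_attained[S C_shatters_S _]; have [c Cc _] := C_shatters_S set0; exists c.
Qed.

Lemma nontrivial_VCdim_gt0 C (k : nat) : VCdim R C = k%:R%:E -> nontrivial C -> (0 < k)%N.
Proof.
move=> Ck [c [c' [x [Cc Cc' cc']]]].
have label_x (b : bool) : exists2 c1, C c1 & c1 x = b.
  have [cb|] := eqVneq (c x) b; first by exists c.
  by move: cc'; case: b; case cx: (c x); case c'x: (c' x) => // _ _; exists c'.
suff : ((#|` [fset x]%fset|%:R : R)%:E <= k%:R%:E)%E by rewrite cardfs1 lee_fin ler_nat.
rewrite -Ck; apply: ereal_sup_ubound; exists [fset x]%fset => // S'.
have [c1 Cc1 c1x] := label_x `[< S' x >]; exists c1 => // y; rewrite inE => /eqP ->.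
by rewrite c1x; split => /asboolP.
Qed.

Lemma PRDim_gt0_nontrivial C (d : R) : PRDim R C = d%:E -> 0 < d -> nontrivial C.
Proof.
move=> Cd d_gt0; apply: contrapT => C_trivial.
suff : (PRDim R C <= (ln (1%:R : R))%:E)%E by rewrite ln1 Cd lee_fin leNgt d_gt0.
have [h0 h0_eq] : exists h0, forall c, C c -> c = h0.
  have [[c Cc]|no_c] := pselect (C !=set0).
    by exists c => c' Cc'; exact: trivial_eq Cc Cc'.
  by exists (cst false : hypothesis X) => c Cc; case: no_c; exists c.
apply: (@PRDim_le_ln_tuple _ _ _ C 1 unit (fun=> 1) (fun=> h0)) => //; last by rewrite subrr expr1.
split; first by split=> //; rewrite sumr_const_mull card_unit mulr1.
move=> c D /h0_eq ->; rewrite (big_pred1 tt)// => -[].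
by rewrite disagreementxx divr_ge0.
Qed.

(* A hypothesis cannot be [1/4]-close to both concepts under the point mass at [x]. *)
Lemma nontrivial_PRDim_ge C (d : R) : PRDim R C = d%:E -> nontrivial C -> 1 / 6 <= d.
Proof.
move=> Cd [c [c' [x [Cc Cc' cc']]]].
have [I [p [h [pmf_p p_covers]]]] := PRDim_prior Cd; have [p_ge0 p_mass] := pmf_p.
pose D : probability X R := dirac x.
have close_eq c1 i : disagreement D c1 (h i) <= 1 / 4 -> h i x = c1 x.
  rewrite -lee_fin -disagreementE /D/= diracE mem_setE unfold_in lee_fin.
  by case: (eqVneq (c1 x) (h i x)) => [->//|_] /=; lra.
have : \sum_(i | disagreement D c (h i) <= 1 / 4) p i +
       \sum_(i | disagreement D c' (h i) <= 1 / 4) p i <= 1.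
  rewrite -[leRHS]p_mass [X in X + _]big_mkcond [X in _ + X]big_mkcond -big_split/=.
  apply: ler_sum => i _; case: ifPn => [/close_eq hc|_]; case: ifPn => [/close_eq hc'|_];
    rewrite ?addr0 ?add0r//.
  by move: cc'; rewrite -hc -hc' eqxx.
have := p_covers c D Cc; have := p_covers c' D Cc'; have := expR_ge1Dx (- d); lra.
Qed.

End nontrivial_classes.

Section privacy_lower_bound.
Context (R : realType) (disp : measure_display) (X : measurableType disp).
Context (C : set (hypothesis X)) (alpha eps : R) (n m : nat)
  (A : algorithm (X * bool)%type R (hypothesis X) n m).

Lemma realizable_correct (D : probability X R) c : C c ->
  task_correct (agn C alpha) (distribution D (labelled c)) `<=`
    [set h | disagreement D c h <= alpha].
Proof.
move=> Cc h /= h_correct; rewrite -err_labelled -lee_fin -ErrE (le_trans h_correct)//.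
rewrite -[leRHS]add0e leeD2r//; apply: ereal_inf_lbound; exists c => //.
by rewrite -[LHS]/(Err _ c) ErrE err_labelled disagreementxx.
Qed.

Hypotheses (A_DP : user_level_DP eps 0 A) (A_solves : solves (agn C alpha) A).

(* By group privacy, the output law on a fixed dataset is almost as good as the one on
   samples labelled by any given concept. *)
Lemma DP_prior :
  prior C alpha (1 / 2 * expR (- (eps * n%:R)))
    (fun o : alg_outputs A => alg_prob A (nseq_tuple n (nseq_tuple m point)) (val o)) val.
Proof.
set x0 := nseq_tuple n _; split.
  split; first by move=> o; exact: alg_prob_ge0.
  by have := alg_prob_sum1 A x0; rewrite big_seq_fsetE.
move=> c D Cc.
set G := task_correct (agn C alpha) (distribution D (labelled c)).
have [x x_hit] : exists x, 1 / 2 <= alg_in A x G.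
  apply: contrapT => no_hit.
  have := solves_Rintegral_ge A_solves (D := distribution D (labelled c)) Logic.I.
  rewrite -/G leNgt => /negP; apply; apply: (@le_lt_trans _ _ (1 / 2)); last lra.
  apply: Rintegral_le_cst => [|x]; first exact: bounded_measurable_alg_in.
  by rewrite leNgt; apply/negP => /ltW x_hit; apply: no_hit; exists x.
apply: (@le_trans _ _ (alg_in A x0 [set h | disagreement D c h <= alpha])).
  apply: le_trans (le_alg_in _ _ (realizable_correct Cc)).
  rewrite mulrC expRN ler_pdivrMl ?expR_gt0//.
  exact: le_trans x_hit (group_privacy _ _ _ A_DP).
by rewrite /alg_in big_seq_fsetE/=; under eq_bigl do rewrite mem_setE.
Qed.

Lemma PRDim_lower_bound (d : R) : PRDim R C = d%:E -> alpha <= 1 / 4 -> 0 <= eps ->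
  d <= eps * n%:R + 6.
Proof.
move=> Cd alpha_le eps_ge0.
have [pmf_p p_covers] := DP_prior; set gamma := 1 / 2 * _ in p_covers.
have users_ge0 : 0 <= eps * n%:R by rewrite mulr_ge0.
have gamma_gt0 : 0 < gamma by rewrite mulr_gt0 ?expR_gt0.
have gamma_le1 : gamma <= 1.
  have : expR (- (eps * n%:R)) <= 1 by rewrite expR_le1 oppr_le0.
  by rewrite /gamma; lra.
have : (PRDim R C <= (ln (3 / gamma))%:E)%E.
  apply: (PRDim_le_ln_prior (conj pmf_p _)); last by rewrite gamma_gt0.
  move=> c D Cc; rewrite (le_trans (p_covers c D Cc))//.
  by apply: finite_pmf_event_le => // o h_close; exact: le_trans h_close alpha_le.
rewrite Cd lee_fin => /le_trans; apply.
rewrite (_ : 3 / gamma = 6 * expR (eps * n%:R)); last first.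
  by rewrite /gamma expRN; field; rewrite gt_eqF ?expR_gt0.
rewrite lnM ?posrE ?expR_gt0// expRK addrC lerD2l.
by apply/ltW/ln_sublinear.
Qed.

End privacy_lower_bound.

(** * Boosting a prior *)

Section majority.
Context (disp : measure_display) (X : measurableType disp).
Implicit Types (c h : hypothesis X) (s : seq (hypothesis X)).

Definition votes s (x : X) : nat := count (fun h : hypothesis X => h x) s.

Lemma measurable_votes s : measurable_fun setT (votes s).
Proof.
rewrite /votes; elim: s => [|h s IHs] /=; first exact: measurable_cst.
by apply: measurable_fun_addn => //; exact: (@measurableT_comp _ _ _ _ _ _ nat_of_bool).
Qed.

Definition majority_fun s (x : X) : bool := (size s < 2 * votes s x)%N.

Lemma measurable_majority s : measurable_fun setT (majority_fun s).
Proof.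
rewrite /majority_fun; under eq_fun do rewrite mul2n -addnn.
apply: measurable_fun_ltn; first exact: measurable_cst.
by apply: measurable_fun_addn; exact: measurable_votes.
Qed.

HB.instance Definition _ s :=
  isMeasurableFun.Build _ _ _ _ (majority_fun s) (measurable_majority s).

Definition majority s : hypothesis X := majority_fun s.

Lemma majority_neq_count_le c s x : c x != majority s x ->
  (2 * count (fun h : hypothesis X => h x == c x) s <= size s)%N.
Proof.
rewrite /= /majority_fun /votes; have := count_predC (fun h : hypothesis X => h x) s.
case cx: (c x) => count_sum; case: ltnP => // maj _.
  by under eq_count do rewrite eqb_id.
rewrite (@eq_count _ _ (predC (fun h : hypothesis X => h x))); first by lia.
by move=> h; rewrite /= eqbF_neg.
Qed.

End majority.

Section boosting.
Context (R : realType) (disp : measure_display) (X : measurableType disp).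
Implicit Types (C : set (hypothesis X)) (c h : hypothesis X) (s : seq (hypothesis X))
  (D : probability X R).

Definition boost_weight c h (x : X) : R := 1 / 3 + 2 / 3 * differ R c h x.

Definition potential c s (x : X) : R := \prod_(h <- s) boost_weight c h x.

Lemma boost_weight_gt0 c h x : 0 < boost_weight c h x.
Proof. by rewrite /boost_weight /differ; case: (c x != h x) => /=; lra. Qed.

Lemma bounded_measurable_boost_weight c h : bounded_measurable (boost_weight c h).
Proof. by rewrite /boost_weight. Qed.

Lemma bounded_measurable_potential c s : bounded_measurable (potential c s).
Proof. by apply: bounded_measurable_prod => h; exact: bounded_measurable_boost_weight. Qed.

Lemma potential_ge0 c s x : 0 <= potential c s x.
Proof. by apply: prodr_ge0 => h _; exact/ltW/boost_weight_gt0. Qed.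

Lemma potentialE c s x :
  potential c s x = (1 / 3) ^+ count (fun h : hypothesis X => h x == c x) s.
Proof.
rewrite /potential; elim: s => [|h s IHs]; first by rewrite big_nil.
rewrite big_cons IHs /= exprD /boost_weight /differ [c x == _]eq_sym; congr (_ * _).
by case: (h x == c x); rewrite /= ?expr1 ?expr0; lra.
Qed.

Lemma differ_majority_le c s x k : size s = (2 * k)%N ->
  differ R c (majority s) x <= 3 ^+ k * potential c s x.
Proof.
move=> size_s; rewrite /differ; case: (boolP (c x != _)) => [|_]; last first.
  by rewrite mulr_ge0 ?exprn_ge0 ?potential_ge0.
move=> /majority_neq_count_le; rewrite size_s leq_pmul2l// potentialE => count_le.
apply: (@le_trans _ _ (3 ^+ k * (1 / 3) ^+ k)).
  by rewrite -exprMn mulrC divfK// expr1n.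
by rewrite ler_wpM2l ?exprn_ge0//; apply: ler_wiXn2l => //; lra.
Qed.

Lemma boost_reweight D c h : exists D' : probability X R, forall f, bounded_measurable f ->
  \int[D]_x (boost_weight c h x * f x) =
  (1 / 3 + 2 / 3 * disagreement D c h) * \int[D']_x f x.
Proof.
have b_weight := bounded_measurable_boost_weight c h.
set W := 1 / 3 + 2 / 3 * disagreement D c h.
have W_gt0 : 0 < W by have := disagreement_ge0 D c h; rewrite /W; lra.
have weight_mass : \int[D]_x boost_weight c h x = W.
  by rewrite /boost_weight RintegralD// Rintegral_probability_cst RintegralZl.
have [||| D' D'E] := @density_law _ _ _ D (fun x => W^-1 * boost_weight c h x).
- by apply: bounded_measurableM => //; exact: bounded_measurable_cst.
- by move=> x; rewrite mulr_ge0 ?invr_ge0 ?(ltW W_gt0) ?(ltW (boost_weight_gt0 _ _ _)).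
- by rewrite RintegralZl// weight_mass mulVf// gt_eqF.
exists D' => f bf; rewrite D'E// -RintegralZl//.
by apply: eq_Rintegral => x _; field; rewrite gt_eqF.
Qed.

(* A draw that is [1/4]-accurate under the current law at least halves the potential;
   the next draw is judged under the law reweighted towards its errors. *)
Lemma boost_potential C (gamma : R) (I : finType) (p : I -> R) (h : I -> hypothesis X) :
  prior C (1 / 4) gamma p h -> 0 <= gamma -> forall n c D, C c ->
  gamma ^+ n <=
  \sum_(t : n.-tuple I | \int[D]_x potential c (map h t) x <= (1 / 2) ^+ n) tuple_pmf n p t.
Proof.
move=> [[p_ge0 _] p_covers] gamma_ge0; elim=> [|n IHn] c D Cc.
  rewrite big_mkcond sum_tuple0 expr0 tuple_pmf0.
  under eq_Rintegral do rewrite /potential big_nil.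
  by rewrite Rintegral_probability_cst expr0 lexx.
rewrite big_mkcond sum_tupleS.
apply: (@le_trans _ _ (\sum_(i | disagreement D c (h i) <= 1 / 4) p i * gamma ^+ n)).
  by rewrite -mulr_suml exprS ler_wpM2r ?exprn_ge0// p_covers.
rewrite [leLHS]big_mkcond; apply: ler_sum => i _; case: ifPn => [close_i|_]; last first.
  by apply: sumr_ge0 => t _; case: ifP => // _; exact: tuple_pmf_ge0.
have [D' D'E] := boost_reweight D c (h i).
apply: le_trans (ler_wpM2l (p_ge0 i) (IHn c D' Cc)) _.
rewrite mulr_sumr [leLHS]big_mkcond; apply: ler_sum => t _; case: ifPn => [small_t|_]; last first.
  by case: ifP => // _; exact: tuple_pmf_ge0.
rewrite tuple_pmf_cons ifT//.
under eq_Rintegral do rewrite /potential/= big_cons.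
rewrite D'E; last exact: bounded_measurable_potential.
rewrite exprS ler_pM//.
- by have := disagreement_ge0 D c (h i); lra.
- by apply: Rintegral_ge0 => x _; exact: potential_ge0.
- by lra.
Qed.

Lemma boosted_prior C (gamma : R) (I : finType) (p : I -> R) (h : I -> hypothesis X) k :
  prior C (1 / 4) gamma p h -> 0 <= gamma ->
  prior C ((3 / 4) ^+ k) (gamma ^+ (2 * k)) (tuple_pmf (2 * k) p)
    (fun t => majority (map h t)).
Proof.
move=> prior_p gamma_ge0; have [pmf_p _] := prior_p.
have pmf_tuple := finite_pmf_tuple (2 * k) pmf_p; split=> // c D Cc.
apply: (le_trans (boost_potential prior_p gamma_ge0 (2 * k) D Cc)).
apply: finite_pmf_event_le => // t potential_le.
apply: (@le_trans _ _ (3 ^+ k * \int[D]_x potential c (map h t) x)).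
  have b_potential := bounded_measurable_potential c (map h t).
  rewrite -RintegralZl//; apply: le_Rintegral => // x _.
  by apply: differ_majority_le; rewrite size_map size_tuple.
have -> : (3 / 4) ^+ k = 3 ^+ k * (1 / 2) ^+ (2 * k) :> R.
  by rewrite exprM -exprMn; congr (_ ^+ _); field.
by rewrite ler_wpM2l ?exprn_ge0.
Qed.

End boosting.

(** * Comparing two hypotheses on the data of one user *)

Section clipping.
Context (R : realType).
Implicit Types B y s : R.

Definition clip B y : R := Num.max (- B) (Num.min y B).

Lemma normr_clip_le B y : 0 <= B -> `|clip B y| <= B.
Proof.
move=> B_ge0; rewrite ler_norml /clip le_max lexx /= ge_max ge_min lexx orbT andbT.
by lra.
Qed.

Lemma ler_clip B : {homo clip B : x y / x <= y}.
Proof.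
move=> x y xy; rewrite /clip ge_max !le_max lexx /=; apply/orP; right.
by rewrite le_min !ge_min xy lexx orbT.
Qed.

Lemma clipN B y : 0 <= B -> clip B (- y) = - clip B y.
Proof.
move=> B_ge0; rewrite /clip.
by rewrite !maxEle !minEle; do ! case: ifPn; rewrite -?ltNge; lra.
Qed.

Lemma clip_ge B s y : 0 < s -> 0 <= B -> y - s^-1 * expR (s * (y - B)) <= clip B y.
Proof.
move=> s_gt0 B_ge0.
have excess_ge0 : 0 <= s^-1 * expR (s * (y - B)) by rewrite mulr_ge0 ?expR_ge0 ?invr_ge0 ?ltW.
have excess_ge : y - B <= s^-1 * expR (s * (y - B)).
  by rewrite ler_pdivlMl// (le_trans _ (expR_ge1Dx _))//; lra.
by rewrite /clip le_max le_min; apply/orP; right; apply/andP; split; lra.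
Qed.

Lemma bounded_measurable_clip (d : measure_display) (T : measurableType d) B (f : T -> R) :
  0 <= B -> bounded_measurable f -> bounded_measurable (fun x => clip B (f x)).
Proof.
move=> B_ge0 [mf _]; split; last by exists B => x; exact: normr_clip_le.
apply: measurable_maxr; first exact: measurable_cst.
by apply: measurable_minr => //; exact: measurable_cst.
Qed.

Lemma Rintegral_expR_le (d : measure_display) (T : measurableType d) (P : probability T R)
    (f : T -> R) (b : R) :
  bounded_measurable f -> (forall x, `|f x| <= b) -> b <= 1 / 3 ->
  \int[P]_x expR (f x) <= 1 + \int[P]_x f x + b ^+ 2.
Proof.
move=> bf f_le b_le.
have -> : 1 + \int[P]_x f x + b ^+ 2 = \int[P]_x (1 + b ^+ 2 + f x).
  by rewrite RintegralD// Rintegral_probability_cst addrAC.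
apply: le_Rintegral => // x _.
have := f_le x; rewrite ler_norml => /andP[f_ge f_leb].
have f_sqr : f x ^+ 2 <= b ^+ 2 by nra.
by have := @expR_le1DxDsqr _ (f x); rewrite (le_trans f_leb)// => /(_ isT); lra.
Qed.

End clipping.

#[local] Hint Resolve bounded_measurable_clip : bounded_measurable.

Section empirical_gap.
Context (R : realType) (disp : measure_display) (X : measurableType disp) (m : nat).
Implicit Types (h : hypothesis X) (z : m.-tuple (X * bool)) (D : probability (X * bool)%type R).

Definition empirical_gap h h' z : R := m%:R^-1 * \sum_(y <- z) (miss R h y - miss R h' y).

Lemma bounded_measurable_empirical_gap h h' : bounded_measurable (empirical_gap h h').
Proof. by rewrite /empirical_gap. Qed.

Lemma empirical_gapN h h' z : empirical_gap h' h z = - empirical_gap h h' z.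
Proof. by rewrite /empirical_gap -mulrN -sumrN; under [in RHS]eq_bigr do rewrite opprB. Qed.

Definition deviation D h h' z : R := empirical_gap h h' z - (err D h - err D h').

Lemma bounded_measurable_deviation D h h' : bounded_measurable (deviation D h h').
Proof.
apply: bounded_measurableD; first exact: bounded_measurable_empirical_gap.
exact: bounded_measurable_cst.
Qed.

Hypothesis m_gt0 : (0 < m)%N.

Let centered D h h' (y : X * bool) : R := miss R h y - miss R h' y - (err D h - err D h').

Let bounded_measurable_centered D h h' : bounded_measurable (centered D h h').
Proof. by rewrite /centered. Qed.

Let Rintegral_centered D h h' : \int[D]_y centered D h h' y = 0.
Proof. by rewrite !RintegralB// !Rintegral_probability_cst subrr. Qed.

Let normr_centered_le D h h' y : `|centered D h h' y| <= 2.
Proof.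
have := err_ge0 D h; have := err_ge0 D h'; have := err_le1 D h; have := err_le1 D h'.
by rewrite ler_norml /centered /miss; case: (h _ != _); case: (h' _ != _) => /=; lra.
Qed.

Let deviationE D h h' z : deviation D h h' z = m%:R^-1 * \sum_(y <- z) centered D h h' y.
Proof.
rewrite /deviation /empirical_gap [in RHS]sumrB.
rewrite big_const_seq count_predT size_tuple iter_addr addr0.
by rewrite -(mulr_natl (err D h - err D h') m) mulrBr mulKf// pnatr_eq0 -lt0n.
Qed.

Lemma Rintegral_deviation D h h' : \int[iid D m]_z deviation D h h' z = 0.
Proof.
under eq_Rintegral do rewrite deviationE.
by rewrite RintegralZl// Rintegral_iid_sum// Rintegral_centered !mulr0.
Qed.

Lemma Rintegral_expR_deviation_le D h h' (l : R) : `|l| <= m%:R / 6 ->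
  \int[iid D m]_z expR (l * deviation D h h' z) <= expR (4 * l ^+ 2 / m%:R).
Proof.
move=> l_le; have mR_gt0 : 0 < m%:R :> R by rewrite ltr0n.
set q := l / m%:R.
have q_le : 2 * `|q| <= 1 / 3.
  by rewrite normrM normfV (ger0_norm (ltW mR_gt0)) mulrA ler_pdivrMr//; lra.
under eq_Rintegral => z _ do rewrite deviationE mulrA -/q mulr_sumr expR_sum.
rewrite Rintegral_iid_prod//.
have one_example : \int[D]_y expR (q * centered D h h' y) <= 1 + 4 * q ^+ 2.
  apply: le_trans (Rintegral_expR_le D (b := 2 * `|q|) _ _ q_le) _ => //.
    by move=> y; rewrite normrM mulrC ler_wpM2r.
  rewrite RintegralZl// Rintegral_centered mulr0 addr0 exprMn real_normK ?num_real//; lra.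
apply: (@le_trans _ _ ((1 + 4 * q ^+ 2) ^+ m)).
  rewrite lerXn2r// nnegrE; first by apply: Rintegral_ge0 => y _; exact: expR_ge0.
  by rewrite addr_ge0// mulr_ge0// sqr_ge0.
have -> : 4 * l ^+ 2 / m%:R = 4 * q ^+ 2 * m%:R by rewrite /q; field; rewrite gt_eqF.
by apply: exprn1D_le_expR; have := sqr_ge0 q; lra.
Qed.

End empirical_gap.

#[local] Hint Extern 1 (bounded_measurable _) =>
  first [exact: bounded_measurable_empirical_gap | exact: bounded_measurable_deviation]
  : bounded_measurable.

Section clipped_comparison.
Context (R : realType) (disp : measure_display) (X : measurableType disp).
Context (D : probability (X * bool)%type R) (alpha : R) (m : nat).
Hypotheses (m_gt0 : (0 < m)%N) (alpha_gt0 : 0 < alpha) (alpha_le1 : alpha <= 1).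
Implicit Types h : hypothesis X.

(* Beyond half the accuracy, a deviation of the empirical gap of order
   [ln (1 / alpha) / sqrt m] has probability at most about [alpha]. *)
Definition clip_level : R := alpha / 2 + 6 * ln (128 / alpha) / Num.sqrt m%:R.

Local Notation B := clip_level.

Let s : R := Num.sqrt m%:R / 6.

Let sqrt_m_ge1 : 1 <= Num.sqrt m%:R :> R.
Proof. by rewrite -[leLHS]sqrtr1 ler_wsqrtr// ler1n. Qed.

Let s_gt0 : 0 < s.
Proof. by rewrite /s; have := sqrt_m_ge1; lra. Qed.

Lemma clip_level_ge : alpha / 2 <= B.
Proof.
rewrite lerDl divr_ge0 ?sqrtr_ge0// mulr_ge0// ln_ge0// ler_pdivlMr//.
by have := alpha_le1; lra.
Qed.

Lemma clip_level_gt0 : 0 < B.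
Proof. by have := clip_level_ge; have := alpha_gt0; lra. Qed.

Let B_ge0 : 0 <= B.
Proof. exact/ltW/clip_level_gt0. Qed.

Lemma Rintegral_expR_scaled_deviation_le h h' :
  \int[iid D m]_z expR (s * deviation D h h' z) <= 11 / 9.
Proof.
have mR_gt0 : 0 < m%:R :> R by rewrite ltr0n.
have s_sqr : s ^+ 2 = m%:R / 36 by rewrite exprMn sqr_sqrtr//; field.
have s_ge : 1 / 6 <= s by rewrite /s; have := sqrt_m_ge1; lra.
apply: le_trans (Rintegral_expR_deviation_le m_gt0 _ _ _ _) _.
  by rewrite (ger0_norm (ltW s_gt0)); nra.
have -> : 4 * s ^+ 2 / m%:R = 1 / 9 by rewrite s_sqr; field; rewrite gt_eqF.
by apply: (le_trans (expR_le1D2x _)); lra.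
Qed.

Lemma clipped_tail_le (delta : R) : delta <= alpha / 2 ->
  s^-1 * expR (s * (delta - B)) * (11 / 9) <= alpha / 16.
Proof.
move=> delta_le.
have exp_le : expR (s * (delta - B)) <= alpha / 128.
  have -> : alpha / 128 = expR (s * (alpha / 2 - B)).
    have -> : s * (alpha / 2 - B) = - ln (128 / alpha).
      by rewrite /s /clip_level; field; rewrite gt_eqF// (lt_le_trans ltr01).
    by rewrite expRN lnK ?posrE ?divr_gt0// invf_div.
  by rewrite ler_expR ler_pM2l// lerD2r.
have sV_le : s^-1 <= 6 by rewrite invf_ple ?posrE//; rewrite /s; have := sqrt_m_ge1; lra.
have sV_ge0 : 0 <= s^-1 by rewrite invr_ge0 ltW.
by have := ler_pM sV_ge0 (expR_ge0 _) sV_le exp_le; have := alpha_gt0; lra.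
Qed.

Lemma Rintegral_clip_gap_ge h h' (delta : R) : delta <= alpha / 2 -> err D h' + delta <= err D h ->
  delta - alpha / 16 <= \int[iid D m]_z clip B (empirical_gap R h h' z).
Proof.
move=> delta_le err_gap.
apply: (@le_trans _ _ (\int[iid D m]_z (deviation D h h' z + delta
    - s^-1 * expR (s * (delta - B)) * expR (s * deviation D h h' z)))).
  rewrite RintegralB// RintegralD// RintegralZl// Rintegral_deviation// add0r.
  rewrite Rintegral_probability_cst lerD2l lerN2 (le_trans _ (clipped_tail_le delta_le))//.
  rewrite ler_wpM2l ?mulr_ge0 ?expR_ge0 ?invr_ge0 ?(ltW s_gt0)//.
  exact: Rintegral_expR_scaled_deviation_le.
apply: le_Rintegral => // z _.
apply: (@le_trans _ _ (clip B (deviation D h h' z + delta))).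
  apply: le_trans (clip_ge (deviation D h h' z + delta) s_gt0 B_ge0).
  rewrite -mulrA -expRD -mulrDr.
  by have -> : delta - B + deviation D h h' z = deviation D h h' z + delta - B by ring.
by apply: ler_clip; rewrite /deviation; lra.
Qed.

Lemma Rintegral_clip_gap_le h h' : err D h <= err D h' ->
  \int[iid D m]_z clip B (empirical_gap R h h' z) <= alpha / 16.
Proof.
move=> err_le.
have gap_ge : 0 - alpha / 16 <= \int[iid D m]_z clip B (empirical_gap R h' h z).
  by apply: Rintegral_clip_gap_ge; rewrite ?addr0//; have := alpha_gt0; lra.
have -> : \int[iid D m]_z clip B (empirical_gap R h h' z) =
    - \int[iid D m]_z clip B (empirical_gap R h' h z).
  rewrite -mulN1r -RintegralZl//; apply: eq_Rintegral => z _.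
  by rewrite empirical_gapN clipN// mulN1r.
by lra.
Qed.

(* The exponential moment of the difference of the two clipped comparisons pays at once
   for the sampling error and for the randomness of the mechanism. *)
Lemma comparison_mgf_le h h1 h2 (g : R) : 0 <= g -> g <= alpha / (32 * B ^+ 2) ->
  err D h <= err D h1 -> err D h + alpha / 2 <= err D h2 ->
  \int[iid D m]_z expR (g * (clip B (empirical_gap R h h1 z) - clip B (empirical_gap R h2 h z)))
    <= expR (- (g * alpha / 4)).
Proof.
move=> g_ge0 g_le h_le_h1 h_lt_h2.
have B_gt0 := clip_level_gt0; have B_ge := clip_level_ge.
have gB2_le : g * (32 * B ^+ 2) <= alpha by rewrite -ler_pdivlMr// mulr_gt0// exprn_gt0.
have gB_le : g * B <= 1 / 16 by nra.
pose u (z : m.-tuple (X * bool)) :=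
  clip B (empirical_gap R h h1 z) - clip B (empirical_gap R h2 h z).
have bu : bounded_measurable u by rewrite /u.
have u_le z : `|g * u z| <= 2 * g * B.
  rewrite normrM ger0_norm// mulrAC mulrC ler_wpM2r// (le_trans (ler_normB _ _))//.
  have := normr_clip_le (empirical_gap R h h1 z) B_ge0.
  by have := normr_clip_le (empirical_gap R h2 h z) B_ge0; lra.
have u_mean : \int[iid D m]_z u z <= - (3 / 8 * alpha).
  rewrite RintegralB//; have := Rintegral_clip_gap_le h_le_h1.
  by have := Rintegral_clip_gap_ge (lexx (alpha / 2)) h_lt_h2; lra.
apply: le_trans (Rintegral_expR_le _ _ u_le _) _ => //; first lra.
rewrite RintegralZl//; apply: le_trans (expR_ge1Dx _).
have := ler_wpM2l g_ge0 u_mean; have := ler_wpM2l g_ge0 gB2_le; lra.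
Qed.

End clipped_comparison.

(** * Private selection by a soft tournament *)

Lemma measurable_funV_gt0 (R : realType) (d : measure_display) (T : measurableType d) (f : T -> R) :
  (forall x, 0 < f x) -> measurable_fun setT f -> measurable_fun setT (fun x => (f x)^-1).
Proof.
move=> f_gt0 mf; rewrite (_ : (fun x => _) = (fun x => f x `^ (-1))).
  exact: measurableT_comp (measurable_powR _) mf.
by apply/funext => x; rewrite powR_inv1// ltW.
Qed.

Section tournament.
Context (R : realType) (J : finType).
Implicit Types (s : J -> J -> R) (j : J).

(* [ln (soft_loss s j)] is a smooth proxy for the largest margin by which [j] loses
   against another candidate. *)
Definition soft_loss s j : R := \sum_j' expR (s j j').

Definition tournament s j : R := (soft_loss s j)^-1 / \sum_j' (soft_loss s j')^-1.

Lemma soft_loss_ge s j j' : expR (s j j') <= soft_loss s j.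
Proof. by rewrite /soft_loss (bigD1 j')//= lerDl sumr_ge0// => k _; exact: expR_ge0. Qed.

Lemma soft_loss_gt0 s j : 0 < soft_loss s j.
Proof. exact: lt_le_trans (expR_gt0 _) (soft_loss_ge s j j). Qed.

Lemma soft_lossV_le_sum s j : (soft_loss s j)^-1 <= \sum_j' (soft_loss s j')^-1.
Proof.
rewrite (bigD1 j)//= lerDl sumr_ge0// => k _.
by rewrite invr_ge0 ltW// soft_loss_gt0.
Qed.

Lemma sum_soft_lossV_gt0 s j : 0 < \sum_j' (soft_loss s j')^-1.
Proof. by apply: lt_le_trans (soft_lossV_le_sum s j); rewrite invr_gt0 soft_loss_gt0. Qed.

Lemma finite_pmf_tournament s j : finite_pmf (tournament s).
Proof.
split=> [j'|]; last by rewrite -mulr_suml mulfV// gt_eqF// (sum_soft_lossV_gt0 _ j).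
by rewrite divr_ge0 ?invr_ge0 ?ltW ?soft_loss_gt0 ?(sum_soft_lossV_gt0 _ j).
Qed.

Lemma soft_loss_stable s s' (b : R) j : (forall j', s j j' <= s' j j' + b) ->
  soft_loss s j <= expR b * soft_loss s' j.
Proof.
move=> ss'; rewrite /soft_loss mulr_sumr; apply: ler_sum => j' _.
by rewrite -expRD ler_expR addrC.
Qed.

Lemma tournament_stable s s' (b : R) j : (forall j j', `|s j j' - s' j j'| <= b) ->
  tournament s j <= expR (2 * b) * tournament s' j.
Proof.
move=> ss'.
have inv_stable s1 s2 k : (forall j j', s2 j j' <= s1 j j' + b) ->
    (soft_loss s1 k)^-1 <= expR b * (soft_loss s2 k)^-1.
  move=> s21; rewrite ler_pdivlMr ?soft_loss_gt0// mulrC ler_pdivrMr ?soft_loss_gt0//.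
  exact: soft_loss_stable.
have s'_le k k' : s' k k' <= s k k' + b.
  by have := ss' k k'; rewrite ler_norml => /andP[]; lra.
have s_le k k' : s k k' <= s' k k' + b.
  by have := ss' k k'; rewrite ler_norml => /andP[]; lra.
have sum_stable : \sum_k (soft_loss s' k)^-1 <= expR b * \sum_k (soft_loss s k)^-1.
  by rewrite mulr_sumr; apply: ler_sum => k _; exact: inv_stable.
have sum_gt0 := sum_soft_lossV_gt0 s j; have sum'_gt0 := sum_soft_lossV_gt0 s' j.
rewrite /tournament ler_pdivrMr// mulrA mulrAC ler_pdivlMr//.
apply: le_trans (ler_pM _ _ (inv_stable s s' j s'_le) sum_stable) _.
- by rewrite invr_ge0 ltW// soft_loss_gt0.
- exact: ltW.
by rewrite mulrCA mulrA [expR b * (_ / _)]mulrA -expRD -mulr2n mulr_natl.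
Qed.

Lemma tournament_le_comparison s j j0 :
  tournament s j <= \sum_j' expR (s j0 j' - s j j0).
Proof.
have -> : \sum_j' expR (s j0 j' - s j j0) = soft_loss s j0 / expR (s j j0).
  by rewrite /soft_loss mulr_suml; apply: eq_bigr => j' _; rewrite expRB.
rewrite /tournament mulrC ler_pM ?invr_ge0 ?(ltW (soft_loss_gt0 _ _))//.
- exact/ltW/(sum_soft_lossV_gt0 _ j).
- rewrite -[leRHS]invrK lef_pV2 ?posrE ?invr_gt0 ?soft_loss_gt0 ?(sum_soft_lossV_gt0 _ j)//.
  exact: soft_lossV_le_sum.
- by rewrite lef_pV2 ?posrE ?soft_loss_gt0 ?expR_gt0// soft_loss_ge.
Qed.

Lemma bounded_measurable_tournament (d : measure_display) (T : measurableType d)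
    (s : T -> J -> J -> R) j :
  (forall j j', bounded_measurable (fun x => s x j j')) ->
  bounded_measurable (fun x => tournament (s x) j).
Proof.
move=> bs; split; last first.
  exists 1 => x; have pmf_s := finite_pmf_tournament (s x) j.
  by rewrite ger0_norm; [exact: finite_pmf_le1 | case: pmf_s].
have measurable_loss k : measurable_fun setT (fun x => (soft_loss (s x) k)^-1).
  apply: measurable_funV_gt0 => [x|]; first exact: soft_loss_gt0.
  by have [] : bounded_measurable (fun x => soft_loss (s x) k) by rewrite /soft_loss.
apply: measurable_funM => //; apply: measurable_funV_gt0 => [x|].
  exact: sum_soft_lossV_gt0 j.
exact: measurable_sum.
Qed.

End tournament.

Section selection.
Context (R : realType) (disp : measure_display) (X : measurableType disp).
Context (I : finType) (p : I -> R) (H : I -> hypothesis X) (M n m : nat) (B g : R).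
Hypotheses (pmf_p : finite_pmf p) (M_gt0 : (0 < M)%N) (B_ge0 : 0 <= B) (g_ge0 : 0 <= g).
Local Notation data := (dataset (X * bool)%type n m).
Implicit Types (h : hypothesis X) (x : data) (t : M.-tuple I) (l : 'I_M).

Definition candidate t l : hypothesis X := H (tnth t l).

Definition score x h h' : R := g * \sum_(z <- x) clip B (empirical_gap R h h' z).

Definition candidate_score x t l l' : R := score x (candidate t l) (candidate t l').

Definition selection x (tl : M.-tuple I * 'I_M) : R :=
  tuple_pmf M p tl.1 * tournament (candidate_score x tl.1) tl.2.

Lemma bounded_measurable_score h h' : bounded_measurable (fun x => score x h h').
Proof. by rewrite /score. Qed.

Lemma bounded_measurable_selected t l :
  bounded_measurable (fun x : data => tournament (candidate_score x t) l).
Proof. by apply: bounded_measurable_tournament => j j'; exact: bounded_measurable_score. Qed.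

Lemma finite_pmf_selection x : finite_pmf (selection x).
Proof.
have [tp_ge0 tp_mass] := finite_pmf_tuple M pmf_p.
have tournament_pmf t := finite_pmf_tournament (candidate_score x t) (Ordinal M_gt0).
split; first by move=> [t l]; rewrite mulr_ge0//; case: (tournament_pmf t).
rewrite -(pair_bigA _ (fun t l => selection x (t, l)))/= -tp_mass.
apply: eq_bigr => t _; rewrite /selection/= -mulr_sumr.
by case: (tournament_pmf t) => _ ->; rewrite mulr1.
Qed.

Lemma measurable_selection tl : measurable_fun setT (selection ^~ tl).
Proof.
apply: measurable_funM; first exact: measurable_cst.
by case: (bounded_measurable_selected tl.1 tl.2).
Qed.

Definition selection_algorithm : algorithm (X * bool)%type R (hypothesis X) n m :=
  kernel_algorithm (fun tl => candidate tl.1 tl.2) finite_pmf_selection measurable_selection.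

Lemma score_neighbors x x' h h' : user_neighbors x x' ->
  `|score x h h' - score x' h h'| <= 2 * g * B.
Proof.
move=> [i xx']; rewrite -mulrBr normrM ger0_norm// mulrAC mulrC ler_wpM2r//.
rewrite !big_tuple (bigD1 i)//= [X in _ - X](bigD1 i)//=.
rewrite (eq_bigr (fun j => clip B (empirical_gap R h h' (tnth x' j)))); last by move=> j /xx' ->.
rewrite opprD addrACA subrr addr0 (le_trans (ler_normB _ _))// mulr_natl mulr2n.
by apply: lerD; exact: normr_clip_le.
Qed.

Lemma selection_algorithm_DP eps : 4 * g * B <= eps -> user_level_DP eps 0 selection_algorithm.
Proof.
move=> eps_ge; apply: kernel_algorithm_DP => x x' [t l] xx'.
have [tp_ge0 _] := finite_pmf_tuple M pmf_p.
have [tournament_ge0 _] := finite_pmf_tournament (candidate_score x' t) l.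
rewrite mulrCA ler_wpM2l//.
apply: (le_trans (tournament_stable l (fun j j' => score_neighbors _ _ xx'))).
by rewrite ler_wpM2r// ler_expR; lra.
Qed.

Variables (D : probability (X * bool)%type R) (alpha : R).
Hypotheses (m_gt0 : (0 < m)%N) (alpha_gt0 : 0 < alpha) (alpha_le1 : alpha <= 1)
  (B_def : B = clip_level alpha m) (g_le : g <= alpha / (32 * B ^+ 2)).

Lemma Rintegral_selected_le t l best :
  (forall l', err D (candidate t best) <= err D (candidate t l')) ->
  err D (candidate t best) + alpha / 2 <= err D (candidate t l) ->
  \int[iid (iid D m) n]_x tournament (candidate_score x t) l <=
  M%:R * expR (- (g * alpha / 4)) ^+ n.
Proof.
move=> best_min err_gap.
pose comparison l' (z : m.-tuple (X * bool)) :=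
  clip B (empirical_gap R (candidate t best) (candidate t l') z)
  - clip B (empirical_gap R (candidate t l) (candidate t best) z).
have comparisonE x l' :
    expR (candidate_score x t best l' - candidate_score x t l best) =
    \prod_(z <- x) expR (g * comparison l' z).
  by rewrite -mulrBr -sumrB mulr_sumr expR_sum.
have b_comparison l' : bounded_measurable (fun z => expR (g * comparison l' z)).
  by rewrite /comparison.
have b_selected := bounded_measurable_selected t l.
apply: (@le_trans _ _ (\int[iid (iid D m) n]_x \sum_l' \prod_(z <- x) expR (g * comparison l' z))).
  apply: le_Rintegral => // x _; under eq_bigr do rewrite -comparisonE.
  exact: tournament_le_comparison.
rewrite Rintegral_sum// -[M in leRHS]card_ord -sumr_const_mull.
apply: ler_sum => l' _; rewrite Rintegral_iid_prod//.
rewrite lerXn2r ?nnegrE ?expR_ge0//; first by apply: Rintegral_ge0 => z _; exact: expR_ge0.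
by rewrite /comparison; move: g_le; rewrite B_def => g_le'; exact: comparison_mgf_le.
Qed.

Variables (v : R) (good : set (hypothesis X)).
Hypothesis good_of_err : forall i, err D (H i) <= v + alpha -> good (H i).

Lemma tuple_failure_le t : has (fun i => err D (H i) <= v + alpha / 2) t ->
  \sum_(l | candidate t l \notin good)
    \int[iid (iid D m) n]_x tournament (candidate_score x t) l <=
  M%:R ^+ 2 * expR (- (g * alpha / 4)) ^+ n.
Proof.
move=> /hasP[_ /tnthP[l1 ->] l1_good].
have [best _ best_min] :=
  arg_minP (fun l => err D (candidate t l)) (i0 := Ordinal M_gt0) (P := xpredT) isT.
rewrite expr2 -mulrA -[M in M%:R * _](card_ord M) -sumr_const_mull big_mkcond.
apply: ler_sum => l _; case: ifPn => [l_bad|_]; last first.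
  by rewrite mulr_ge0// exprn_ge0// expR_ge0.
apply: (Rintegral_selected_le (best := best)); first by move=> l'; exact: best_min.
have /negP : ~ err D (candidate t l) <= v + alpha.
  by move=> /good_of_err/mem_set; apply/negP.
by rewrite -ltNge; have := best_min l1 isT; rewrite /candidate in l1_good *; lra.
Qed.

Lemma tuple_success_ge t : has (fun i => err D (H i) <= v + alpha / 2) t ->
  1 - M%:R ^+ 2 * expR (- (g * alpha / 4)) ^+ n <=
  \int[iid (iid D m) n]_x \sum_(l | candidate t l \in good) tournament (candidate_score x t) l.
Proof.
move=> t_good.
have b_selected l : bounded_measurable (fun x : data => tournament (candidate_score x t) l).
  exact: bounded_measurable_selected.
have -> : (fun x : data => \sum_(l | candidate t l \in good) tournament (candidate_score x t) l) =
    fun x => 1 - \sum_(l | candidate t l \notin good) tournament (candidate_score x t) l.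
  apply/funext => x; have [_ mass] := finite_pmf_tournament (candidate_score x t) (Ordinal M_gt0).
  by rewrite -[X in X - _]mass [X in X - _](bigID (fun l => candidate t l \in good))/= addrK.
rewrite RintegralB// Rintegral_probability_cst lerD2l lerN2.
under eq_Rintegral do rewrite -big_filter.
by rewrite Rintegral_sum// big_filter; exact: tuple_failure_le.
Qed.

Lemma selection_algorithm_accurate :
  (1 - \sum_(i | err D (H i) <= v + alpha / 2) p i) ^+ M <= 1 / 12 ->
  M%:R ^+ 2 * expR (- (g * alpha / 4)) ^+ n <= 1 / 12 ->
  2 / 3 <= \int[iid (iid D m) n]_x alg_in selection_algorithm x good.
Proof.
move=> miss_le failure_le.
pose success t x := \sum_(l | candidate t l \in good) tournament (candidate_score x t) l.
have b_success t : bounded_measurable (success t).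
  by apply: bounded_measurable_sum => l; exact: bounded_measurable_selected.
have [tp_ge0 _] := finite_pmf_tuple M pmf_p.
have success_ge0 t x : 0 <= success t x.
  by apply: sumr_ge0 => l _; case: (finite_pmf_tournament (candidate_score x t) l).
have alg_inE x : alg_in selection_algorithm x good = \sum_t tuple_pmf M p t * success t x.
  rewrite alg_in_kernel/= -(pair_big_dep xpredT (fun t l => candidate t l \in good)
    (fun t l => selection x (t, l)))/=.
  by apply: eq_bigr => t _; rewrite mulr_sumr.
under eq_Rintegral do rewrite alg_inE.
rewrite Rintegral_sum; last by move=> t; exact: bounded_measurableM (b_success t).
apply: (@le_trans _ _ (\sum_(t : M.-tuple I | has (fun i => err D (H i) <= v + alpha / 2) t)
    tuple_pmf M p t * (11 / 12))).
  by rewrite -mulr_suml tuple_pmf_has//; lra.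
rewrite big_mkcond; apply: ler_sum => t _.
rewrite RintegralZl//; last exact/bounded_measurable_integrable/b_success.
case: ifPn => [t_good|_]; last by rewrite mulr_ge0// Rintegral_ge0.
rewrite ler_wpM2l//; apply: le_trans (tuple_success_ge t_good); lra.
Qed.

End selection.

(** * Sample complexity *)

Section agnostic_selection.
Context (R : realType) (disp : measure_display) (X : measurableType disp).
Implicit Types (C : set (hypothesis X)) (D : probability (X * bool)%type R).

Lemma ereal_inf_err C D : C !=set0 ->
  exists2 v : R, ereal_inf [set Err D c | c in C] = v%:E &
    forall e, 0 < e -> exists2 c, C c & err D c <= v + e.
Proof.
move=> [c0 Cc0].
have inf_fin : ereal_inf [set Err D c | c in C] \is a fin_num.
  rewrite ge0_fin_numE; last by apply: le_ereal_inf_tmp => _ [c _ <-]; rewrite ErrE lee_fin err_ge0.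
  apply: (@le_lt_trans _ _ (Err D c0)); first by apply: ereal_inf_lbound; exists c0.
  by rewrite ErrE ltry.
exists (fine (ereal_inf [set Err D c | c in C])); first by rewrite fineK.
move=> e e_gt0; have [_ [c Cc <-]] := lb_ereal_inf_adherent e_gt0 inf_fin.
by rewrite ErrE -[in X in X -> _](fineK inf_fin) -EFinD lte_fin => /ltW; exists c.
Qed.

Lemma selection_solves C (alpha gamma eps g : R) (I : finType) (p : I -> R)
    (h : I -> hypothesis X) (M n m k : nat) :
  C !=set0 -> prior C (1 / 4) gamma p h -> 0 <= gamma <= 1 ->
  (0 < m)%N -> 0 < alpha <= 1 -> 0 <= g ->
  4 * g * clip_level alpha m <= eps -> g <= alpha / (32 * clip_level alpha m ^+ 2) ->
  (3 / 4) ^+ k <= alpha / 4 -> (0 < M)%N ->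
  (1 - gamma ^+ (2 * k)) ^+ M <= 1 / 12 ->
  M%:R ^+ 2 * expR (- (g * alpha / 4)) ^+ n <= 1 / 12 ->
  exists A : algorithm (X * bool)%type R (hypothesis X) n m,
    user_level_DP eps 0 A /\ solves (agn C alpha) A.
Proof.
move=> C_neq0 prior_p /andP[gamma_ge0 gamma_le1] m_gt0 /andP[alpha_gt0 alpha_le1] g_ge0.
move=> eps_ge g_le k_ge M_gt0 miss_le failure_le.
have [pmf_boosted boosted_covers] := boosted_prior k prior_p gamma_ge0.
have B_ge0 : 0 <= clip_level alpha m by exact/ltW/clip_level_gt0.
exists (@selection_algorithm R disp X _ _ (fun t : (2 * k).-tuple I => majority (map h t))
  M n m _ g pmf_boosted M_gt0 B_ge0); split; first exact: selection_algorithm_DP.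
move=> D _; rewrite -EFin_Rintegral ?lee_fin; last exact: bounded_measurable_alg_in.
have [v vE v_approx] := ereal_inf_err D C_neq0.
have quarter_gt0 : 0 < alpha / 4 by lra.
have [c Cc c_le] := v_approx _ quarter_gt0.
have close_err (t : (2 * k).-tuple I) :
    disagreement (distribution D (@fst X bool)) c (majority (map h t)) <= (3 / 4) ^+ k ->
    err D (majority (map h t)) <= v + alpha / 2.
  by have := err_le_disagreement D c (majority (map h t)); lra.
apply: (@selection_algorithm_accurate _ _ _ _ _ _ _ _ _ _ _ _ _ _ g_ge0 D alpha _ _ _ _ _ v) => //.
  by move=> t t_le; rewrite /= vE ErrE -EFinD lee_fin.
apply: le_trans miss_le; rewrite lerXn2r ?nnegrE ?subr_ge0 ?exprn_ile1//.
  exact: finite_pmf_event_le1.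
rewrite lerD2l lerN2 (le_trans (boosted_covers c (distribution D (@fst X bool)) Cc))//.
exact: finite_pmf_event_le close_err.
Qed.

End agnostic_selection.

Section parameters.
Context (R : realType).

Definition agnostic_rate (d d' alpha eps : R) (m : nat) : R :=
  d / eps + d' / (alpha * eps * Num.sqrt m%:R) + d' / (alpha ^+ 2 * m%:R).

Variables (alpha eps : R) (m : nat).
Hypotheses (alpha_gt0 : 0 < alpha) (alpha_le : alpha <= 1 / 64)
  (eps_gt0 : 0 < eps) (eps_le : eps <= 1 / 2) (m_gt0 : (0 < m)%N).

Local Notation B := (clip_level alpha m).
Local Notation b := (ln (128 / alpha)).

Lemma agnostic_rate_ge0 d d' : 0 <= d -> 0 <= d' -> 0 <= agnostic_rate d d' alpha eps m.
Proof.
move=> d_ge0 d'_ge0.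
by rewrite !addr_ge0// divr_ge0 ?mulr_ge0 ?exprn_ge0 ?sqrtr_ge0// ltW.
Qed.

Lemma agnostic_rate_diag d :
  agnostic_rate d d alpha eps m = d * agnostic_rate 1 1 alpha eps m.
Proof. by rewrite /agnostic_rate !mul1r !mulrDr. Qed.

Lemma ln_128_div_ge1 : 1 <= b.
Proof.
rewrite -[leLHS]expRK ler_ln_gt0 ?expR_gt0// (le_trans (expR1_le4 R))//.
by rewrite ler_pdivlMr//; have := alpha_le; lra.
Qed.

Lemma boosting_rounds : exists2 k : nat, (3 / 4) ^+ k <= alpha / 4 & k%:R <= 5 * b.
Proof.
have [|k _ /andP[k_ge k_le]] := @exists_natr_itvcc R (4 * ln (4 / alpha)).
  by rewrite mulr_ge0// ln_ge0// ler_pdivlMr//; have := alpha_le; lra.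
exists k.
  have -> : (3 / 4) ^+ k = (1 - 1 / 4) ^+ k :> R by congr (_ ^+ _); field.
  have -> : alpha / 4 = expR (- ln (4 / alpha)) by rewrite expRN lnK ?posrE ?divr_gt0// invf_div.
  by apply: exprnB_le_expRN_div; lra.
have : ln (4 / alpha) <= b by rewrite ler_ln_gt0 ?divr_gt0// ler_pM2r ?invr_gt0//; lra.
by have := ln_128_div_ge1; lra.
Qed.

Definition step_size : R := Num.min (eps / (4 * B)) (alpha / (32 * B ^+ 2)).

Let B_gt0 : 0 < B.
Proof. by apply: clip_level_gt0 => //; have := alpha_le; lra. Qed.

Lemma step_size_gt0 : 0 < step_size.
Proof. by rewrite /step_size lt_min !divr_gt0 ?mulr_gt0 ?exprn_gt0. Qed.

Lemma step_size_private : 4 * step_size * B <= eps.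
Proof.
have : step_size <= eps / (4 * B) by rewrite /step_size ge_min lexx.
by rewrite ler_pdivlMr ?mulr_gt0// mulrCA mulrA.
Qed.

Lemma step_size_accurate : step_size <= alpha / (32 * B ^+ 2).
Proof. by rewrite /step_size ge_min lexx orbT. Qed.

Lemma inv_step_size_le : (step_size * alpha)^-1 <= 2304 * b ^+ 2 * agnostic_rate 1 1 alpha eps m.
Proof.
pose r : R := Num.sqrt m%:R.
have r_gt0 : 0 < r by rewrite sqrtr_gt0 ltr0n.
have invV_le : step_size^-1 <= 4 * B / eps + 32 * B ^+ 2 / alpha.
  rewrite /step_size; case: (leP (eps / (4 * B))) => _; rewrite invf_div ?lerDl ?lerDr.
    by rewrite divr_ge0 ?mulr_ge0 ?exprn_ge0// ltW.
  by rewrite divr_ge0 ?mulr_ge0// ltW.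
set w := (alpha * r)^-1; have w_gt0 : 0 < w by rewrite invr_gt0 mulr_gt0.
have BE : B / alpha = 1 / 2 + 6 * b * w.
  by rewrite /clip_level -/r /w; field; rewrite !gt_eqF.
have -> : agnostic_rate 1 1 alpha eps m = eps^-1 + w * eps^-1 + w ^+ 2.
  rewrite /agnostic_rate -/r /w (_ : m%:R = r ^+ 2); last by rewrite sqr_sqrtr.
  by field; rewrite !gt_eqF.
rewrite invfM (le_trans (ler_wpM2r _ invV_le)) ?invr_ge0 ?(ltW alpha_gt0)//.
have -> : (4 * B / eps + 32 * B ^+ 2 / alpha) * alpha^-1 =
    4 * (B / alpha) * eps^-1 + 32 * (B / alpha) ^+ 2 by field; rewrite !gt_eqF.
rewrite BE; have b_ge1 := ln_128_div_ge1.
have epsV_ge : 2 <= eps^-1 by rewrite -[leLHS]invrK lef_pV2 ?posrE ?invr_gt0//; have := eps_le; lra.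
have b_sqr : b <= b ^+ 2 by rewrite expr2 ler_peMl//; lra.
have weps_ge0 : 0 <= w * eps^-1 by rewrite mulr_ge0 ?(ltW w_gt0)// invr_ge0 ltW.
have sqr_le : (1 / 2 + 6 * b * w) ^+ 2 <= 1 / 2 + 72 * (b ^+ 2 * w ^+ 2).
  by have := sqr_ge0 (1 / 2 - 6 * b * w); nra.
have epsV_sqr : eps^-1 <= b ^+ 2 * eps^-1 by rewrite ler_peMl ?(le_trans b_ge1)//; lra.
have weps_le := ler_wpM2r weps_ge0 b_ge1; have bweps_le := ler_wpM2r weps_ge0 b_sqr.
lra.
Qed.

Lemma candidate_count (G x : R) : expR (- x) <= G <= 1 ->
  exists M : nat, [/\ (0 < M)%N, (1 - G) ^+ M <= 1 / 12 & M%:R <= expR (2 + x)].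
Proof.
move=> /andP[G_ge G_le1]; have G_gt0 := lt_le_trans (expR_gt0 _) G_ge.
have [|M M_gt0 /andP[M_ge M_le]] := @exists_natr_itvcc R (4 / G); first by rewrite divr_ge0// ltW.
exists M; split=> //.
  rewrite (le_trans (exprnB_le_expRN_div (c := 4) _ M_ge)) ?G_gt0//.
  by have := expRN4_le R; lra.
have GV_ge1 : 1 <= G^-1 by rewrite invf_ge1.
have GV_le : G^-1 <= expR x by rewrite -[leRHS]invrK -expRN lef_pV2 ?posrE ?expR_gt0.
rewrite expRD; apply: (@le_trans _ _ (5 * G^-1)); first lra.
by rewrite ler_pM ?expR2_ge5// invr_ge0 ltW.
Qed.

Lemma user_count (d L : R) : 1 / 6 <= d -> 0 <= L -> L <= 82 * b * d ->
  exists2 n : nat, 2 * L - step_size * alpha / 4 * n%:R <= - 4 &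
    n%:R <= 1024 * 2560 * b ^+ 3 * agnostic_rate d d alpha eps m.
Proof.
move=> d_ge L_ge0 L_le; set T := agnostic_rate 1 1 alpha eps m.
have ga_gt0 : 0 < step_size * alpha by rewrite mulr_gt0 ?step_size_gt0.
have [|n _ /andP[n_ge n_le]] := @exists_natr_itvcc R ((8 * L + 16) / (step_size * alpha)).
  by rewrite divr_ge0 ?(ltW ga_gt0)//; lra.
exists n; first by move: n_ge; rewrite ler_pdivrMr//; lra.
have b_ge1 := ln_128_div_ge1.
have T_ge : 2 <= T.
  have [alpha_ge0 eps_ge0] := (ltW alpha_gt0, ltW eps_gt0).
  rewrite /T /agnostic_rate -addrA ler_wpDr//.
    by rewrite addr_ge0 ?divr_ge0 ?mulr_ge0 ?sqrtr_ge0 ?exprn_ge0.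
  by rewrite ler_pdivlMr//; have := eps_le; lra.
have bd_ge : 1 / 6 <= b * d by nra.
have b2_ge1 : 1 <= b ^+ 2 by rewrite exprn_ege1.
have quotient_le : (8 * L + 16) / (step_size * alpha) <= 1024 * b * d * (2304 * b ^+ 2 * T).
  by apply: ler_pM; rewrite ?invr_ge0 ?(ltW ga_gt0) ?inv_step_size_le//; lra.
have b2T_ge : 2 <= b ^+ 2 * T by nra.
have unit_le : 1 / 6 * 2 <= b * d * (b ^+ 2 * T) by rewrite ler_pM.
rewrite agnostic_rate_diag -/T exprS; lra.
Qed.

End parameters.

Section log_factor.
Context (R : realType) (d alpha eps : R).
Hypotheses (d_ge0 : 0 <= d) (alpha_gt0 : 0 < alpha) (alpha_le : alpha <= 1 / 64)
  (eps_gt0 : 0 < eps).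

Lemma prior_mass_bounds : expR (- (d + 1)) <= 6 / 10 * expR (- d) <= 1.
Proof.
rewrite opprD expRD [leLHS]mulrC ler_pM2r ?expR_gt0//; apply/andP; split.
  rewrite expRN -[6 / 10]invf_div lef_pV2 ?posrE ?expR_gt0//.
  by have := expR_ge1Dx (1 : R); lra.
have : expR (- d) <= 1 by rewrite expR_le1 oppr_le0.
by lra.
Qed.

Local Notation l := (ln (3 + d + alpha^-1 + eps^-1)).

Let alphaV_ge : 64 <= alpha^-1.
Proof. by rewrite -[leLHS]invrK lef_pV2 ?posrE ?invr_gt0//; have := alpha_le; lra. Qed.

Let ln_alphaV_le : ln alpha^-1 <= l.
Proof.
have epsV_gt0 : 0 < eps^-1 by rewrite invr_gt0.
by rewrite ler_ln_gt0 ?invr_gt0//; have := d_ge0; lra.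
Qed.

Lemma log_factor_ge1 : 1 <= l.
Proof.
apply: le_trans ln_alphaV_le; rewrite -[leLHS]expRK ler_ln_gt0 ?expR_gt0//.
by have := expR1_le4 R; have := alphaV_ge; lra.
Qed.

Let ln_128_div_le : ln (128 / alpha) <= 3 * l.
Proof.
apply: (@le_trans _ _ (ln (alpha^-1 ^+ 3))).
  rewrite ler_ln_gt0 ?divr_gt0// (exprSr _ 2) ler_pM2r ?invr_gt0//.
  by have := alphaV_ge; nra.
by rewrite lnXn ?invr_gt0// -(mulr_natl (ln _)) ler_pM2l.
Qed.

Lemma ln_128_div_cube_le : ln (128 / alpha) ^+ 3 <= 27 * l ^+ 3.
Proof.
have -> : 27 * l ^+ 3 = (3 * l) ^+ 3 by ring.
have b_ge0 : 0 <= ln (128 / alpha) by have := ln_128_div_ge1 alpha_gt0 alpha_le; lra.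
by rewrite lerXn2r ?nnegrE// (le_trans b_ge0).
Qed.

End log_factor.

Section complexity.
Context (R : realType) (disp : measure_display) (X : measurableType disp).
Variables (C : set (hypothesis X)) (d : R) (dVC : nat) (alpha eps : R) (m : nat).
Hypotheses (C_PRDim : PRDim R C = d%:E) (C_VCdim : VCdim R C = dVC%:R%:E)
  (alpha_gt0 : 0 < alpha) (alpha_le : alpha <= 1 / 64)
  (eps_gt0 : 0 < eps) (eps_le : eps <= 1 / 2) (m_gt0 : (0 < m)%N).

Local Notation b := (ln (128 / alpha)).
Local Notation gamma := (6 / 10 * expR (- d)).

Let d_ge0 : 0 <= d. Proof. exact: PRDim_ge0 C_PRDim. Qed.

Lemma nontrivial_upper_bound : nontrivial C ->
  exists2 n : nat, (exists A : algorithm (X * bool)%type R (hypothesis X) n m,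
      user_level_DP eps 0 A /\ solves (agn C alpha) A) &
    n%:R <= 1024 * 2560 * b ^+ 3 * agnostic_rate d d alpha eps m.
Proof.
move=> C_nontrivial; have d_ge := nontrivial_PRDim_ge C_PRDim C_nontrivial.
have [gamma_ge gamma_le1] := andP (prior_mass_bounds d_ge0).
have [I [p [h prior_p]]] := PRDim_prior C_PRDim.
have [k k_ge k_le] := boosting_rounds alpha_gt0 alpha_le.
pose x := (2 * k)%:R * (d + 1).
have [|M [M_gt0 miss_le M_le]] := @candidate_count _ (gamma ^+ (2 * k)) x.
  rewrite exprn_ile1 ?(le_trans _ gamma_ge) ?expR_ge0// andbT.
  by rewrite /x -mulrN mulrC expRM_natr lerXn2r ?nnegrE ?(le_trans _ gamma_ge) ?expR_ge0.
have b_ge1 := ln_128_div_ge1 alpha_gt0 alpha_le.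
have x_le : 2 + x <= 82 * b * d.
  have : k%:R * (d + 1) <= 5 * b * (7 * d) by rewrite ler_pM//; lra.
  by rewrite /x natrM; nra.
have [|n n_ge n_le] := user_count alpha_gt0 alpha_le eps_gt0 eps_le m_gt0 d_ge _ x_le.
  by rewrite addr_ge0// mulr_ge0//; lra.
exists n => //; apply: (selection_solves (VCdim_class_neq0 C_VCdim) prior_p _ m_gt0 _ _
  (step_size_private eps m alpha_gt0 alpha_le) (step_size_accurate alpha eps m) k_ge M_gt0 miss_le).
- by rewrite gamma_le1 andbT (le_trans _ gamma_ge) ?expR_ge0.
- by rewrite alpha_gt0; have := alpha_le; lra.
- exact/ltW/step_size_gt0.
apply: (@le_trans _ _ (expR (- 4))); last by have := expRN4_le R; lra.
apply: (@le_trans _ _ (expR (2 + x) ^+ 2 * expR (- (step_size alpha eps m * alpha / 4)) ^+ n)).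
  by rewrite ler_wpM2r ?exprn_ge0 ?expR_ge0// lerXn2r ?nnegrE ?expR_ge0.
by rewrite -!expRM_natr -expRD ler_expR; lra.
Qed.

Lemma trivial_upper_bound : ~ nontrivial C ->
  exists A : algorithm (X * bool)%type R (hypothesis X) 0 m,
    user_level_DP eps 0 A /\ solves (agn C alpha) A.
Proof.
move=> C_trivial; have [c Cc] := VCdim_class_neq0 C_VCdim.
have pmf_unit (x : dataset (X * bool)%type 0 m) : finite_pmf (fun _ : unit => 1 : R).
  by split=> [_|]; rewrite ?ler01// big_const card_unit/= addr0.
exists (kernel_algorithm (fun=> c) pmf_unit (fun _ => measurable_cst _)); split.
  apply: kernel_algorithm_DP => _ _ _ _; rewrite mulr1 -[leLHS]expR0 ler_expR.
  exact: ltW.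
move=> D _; rewrite -EFin_Rintegral ?lee_fin; last exact: bounded_measurable_alg_in.
apply: Rintegral_ge_cst => [|x]; first exact: bounded_measurable_alg_in.
have c_correct : c \in task_correct (agn C alpha) D.
  rewrite inE /=; apply: (@le_trans _ _ (ereal_inf [set Err D c' | c' in C])).
    by apply: le_ereal_inf_tmp => _ [c' /(trivial_eq C_trivial Cc) -> <-].
  by rewrite leeDl// lee_fin ltW.
by rewrite alg_in_kernel c_correct big_const card_unit/=; lra.
Qed.

Lemma user_complexity_le : (user_complexity (agn C alpha) m eps 0 <=
  (1024 * 2560 * b ^+ 3 * agnostic_rate d d alpha eps m)%:E)%E.
Proof.
have [C_nontrivial|C_trivial] := pselect (nontrivial C).
  have [n n_suffices n_le] := nontrivial_upper_bound C_nontrivial.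
  by apply: (@le_trans _ _ (n%:R)%:E); rewrite ?lee_fin//; apply: ereal_inf_lbound; exists n.
apply: (@le_trans _ _ (0%:R)%:E).
  by apply: ereal_inf_lbound; exists 0%N => //; exact: trivial_upper_bound.
have b_ge1 := ln_128_div_ge1 alpha_gt0 alpha_le.
by rewrite lee_fin !mulr_ge0 ?ler0n ?agnostic_rate_ge0 ?exprn_ge0//; lra.
Qed.

Lemma user_complexity_ge :
  ((agnostic_rate d dVC%:R alpha eps m / (1024 * 256))%:E <=
    user_complexity (agn C alpha) m eps 0)%E.
Proof.
apply: le_ereal_inf_tmp => _ [n [A [A_DP A_solves]] <-].
rewrite lee_fin ler_pdivrMr ?mulr_gt0 ?ltr0n//.
have [S C_shatters_S card_S] := VCdim_attained C_VCdim.
have alpha_ge0 := ltW alpha_gt0; have eps_ge0 := ltW eps_gt0.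
have r_gt0 : 0 < Num.sqrt m%:R :> R by rewrite sqrtr_gt0 ltr0n.
have PRDim_le : d / eps <= 61 * n%:R.
  rewrite ler_pdivrMr//; have [d_gt0|d_le0] := ltP 0 d; last first.
    by rewrite (le_trans d_le0)// !mulr_ge0.
  have dVC_gt0 := nontrivial_VCdim_gt0 C_VCdim (PRDim_gt0_nontrivial C_PRDim d_gt0).
  have := user_count_lower_bound C_shatters_S card_S dVC_gt0 alpha_gt0 alpha_le A_solves A_DP.
  have : 1 <= dVC%:R :> R by rewrite ler1n.
  have alpha_le4 : alpha <= 1 / 4 by have := alpha_le; lra.
  by have := PRDim_lower_bound A_DP A_solves C_PRDim alpha_le4 eps_ge0; lra.
have privacy_le : dVC%:R / (alpha * eps * Num.sqrt m%:R) <= 1280 * n%:R.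
  rewrite ler_pdivrMr ?mulr_gt0//; have [->|dVC_gt0] := posnP dVC.
    by rewrite !mulr_ge0 ?ler0n ?sqrtr_ge0//.
  have := private_sample_lower_bound C_shatters_S card_S dVC_gt0 alpha_gt0 alpha_le
    A_solves eps_gt0 A_DP eps_le.
  by lra.
have sampling_le : dVC%:R / (alpha ^+ 2 * m%:R) <= 1024 * 251 * n%:R.
  rewrite ler_pdivrMr ?mulr_gt0 ?exprn_gt0 ?ltr0n//; have [->|dVC_gt0] := posnP dVC.
    by rewrite !mulr_ge0 ?ler0n ?exprn_ge0.
  have := sample_size_lower_bound C_shatters_S card_S dVC_gt0 alpha_gt0 alpha_le A_solves.
  by lra.
by have : 0 <= n%:R :> R by []; rewrite /agnostic_rate; lra.
Qed.

End complexity.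

Theorem theoremE4 (R : realType) :
  exists (alpha0 eps0 K : R) (p : nat),
    [/\ 0 < alpha0, 0 < eps0, 0 < K &
    forall (disp : measure_display) (X : measurableType disp)
      (C : set (hypothesis X)) (d : R) (dVC : nat),
      PRDim R C = d%:E ->
      VCdim R C = dVC%:R%:E ->
      forall (alpha eps : R) (m : nat),
      0 < alpha <= alpha0 -> 0 < eps <= eps0 -> (0 < m)%N ->
      let L := ln (3 + d + alpha^-1 + eps^-1) ^+ p in
      let n := user_complexity (agn C alpha) m eps 0 in
      (n <= (K * L * (d / eps
                      + d / (alpha * eps * Num.sqrt m%:R)
                      + d / (alpha ^+ 2 * m%:R)))%:E)%E
      /\
      ((K^-1 * L^-1 * (d / eps
                       + dVC%:R / (alpha * eps * Num.sqrt m%:R)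
                       + dVC%:R / (alpha ^+ 2 * m%:R)))%:E <= n)%E].
Proof.
have [K [K_gt0 K_upper K_lower]] :
    exists K : R, [/\ 0 < K, 1024 * 2560 * 27 <= K & 1024 * 256 <= K].
  by exists (1024 * 2560 * 27); split; lra.
exists (1 / 64), (1 / 2), K, 3%N; split=> // disp X C d dVC C_PRDim C_VCdim alpha eps m.
move=> /andP[alpha_gt0 alpha_le] /andP[eps_gt0 eps_le] m_gt0 L n.
have d_ge0 := PRDim_ge0 C_PRDim.
have L_ge1 : 1 <= L by rewrite exprn_ege1// log_factor_ge1.
split.
  apply: le_trans (user_complexity_le C_PRDim C_VCdim alpha_gt0 alpha_le eps_gt0 eps_le m_gt0) _.
  rewrite lee_fin ler_wpM2r ?agnostic_rate_ge0//.
  have b_le : ln (128 / alpha) ^+ 3 <= 27 * L by exact: ln_128_div_cube_le.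
  nra.
apply: le_trans (user_complexity_ge C_PRDim C_VCdim alpha_gt0 alpha_le eps_gt0 eps_le m_gt0).
rewrite lee_fin mulrC ler_wpM2l ?agnostic_rate_ge0// -invfM.
have KL_ge : 1024 * 256 <= K * L by rewrite (le_trans K_lower)// ler_peMr// ltW.
by rewrite lef_pV2 ?posrE ?(lt_le_trans _ KL_ge) ?mulr_gt0 ?ltr0n.
Qed.
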